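(* Let $H$ be a Hilbert space of entire functions, with continuous evaluations, whose evaluators are given by $Z_z(w) = 2\,\frac{\overline{B(z)}A(w)-\overline{A(z)}B(w)}{\overline z-w}$, where $A$ and $B$ are entire functions, real on the real line, with $A$ even and $B$ odd. Let $\sigma=(z_i)_{1\le i\le n}$ be a finite sequence of distinct purely imaginary numbers. Assume that the associated evaluators $Z_{z_1},\dots,Z_{z_n}$ are linearly independent, and that $z_i+z_j\neq 0$ for all $i,j$. Let $H(\sigma)$ be the Hilbert space of the functions $\gamma(z)f(z)$, where $\gamma(z)=\prod_{i=1}^n\frac1{z-z_i}$ and $f\in H$ satisfies $f(z)=0$ for $z\in\sigma$. Put $$\mathcal A_\sigma(w)=\frac{(-1)^{\frac{n(n-1)}2}\gamma(w)\gamma^*(w)}{\det U_n}\begin{vmatrix} A(z_1)&A(z_2)&\dots&A(z_n)&A(w)\\ z_1B(z_1)&z_2B(z_2)&\dots&z_nB(z_n)&wB(w)\\ z_1^2A(z_1)&z_2^2A(z_2)&\dots&z_n^2A(z_n)&w^2A(w)\\ \vdots&\vdots&&\vdots&\vdots\end{vmatrix}_{(n+1)\times(n+1)}$$ $$\mathcal B_\sigma(w)=\frac{(-1)^{\frac{n(n+1)}2}\gamma(w)\gamma^*(w)}{\det V_n}\begin{vmatrix} B(z_1)&B(z_2)&\dots&B(z_n)&B(w)\\ z_1A(z_1)&z_2A(z_2)&\dots&z_nA(z_n)&wA(w)\\ z_1^2B(z_1)&z_2^2B(z_2)&\dots&z_n^2B(z_n)&w^2B(w)\\ \vdots&\vdots&&\vdots&\vdots\end{vmatrix}_{(n+1)\times(n+1)}$$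 where $\det U_n$ and $\det V_n$ are the principal (upper left) $n\times n$ minors of the respective $(n+1)\times(n+1)$ determinants. Then the evaluators $\mathcal K_z$ of $H(\sigma)$ satisfy $$\mathcal K_z(w)=(\mathcal K_w,\mathcal K_z)=2\,\frac{\overline{\mathcal B_\sigma(z)}\mathcal A_\sigma(w)-\overline{\mathcal A_\sigma(z)}\mathcal B_\sigma(w)}{\overline z-w}.$$ The functions $\mathcal A_\sigma$ and $\mathcal B_\sigma$ are entire and real on the real line, $\mathcal A_\sigma$ is even and $\mathcal B_\sigma$ is odd.
   Context: Scalar products are conjugate linear in the first factor and linear in the second. For a Hilbert space $H$ whose vectors are entire functions and for which each evaluation $f\mapsto f(z)$, $z\in\mathbb C$, is continuous, the evaluator $Z_z\in H$ is the vector with $f(z)=(Z_z,f)$ for all $f\in H$; thus $Z_z(w)=(Z_w,Z_z)$. Quotients by $\overline z-w$ are understood at $w=\overline z$ by continuity. The space $H(\sigma)=\{\gamma f: f\in H,\ f(z_1)=\dots=f(z_n)=0\}$ consists of entire functions and is given the Hilbert space structure making $f\mapsto \gamma f$ an isometry from the closed subspace $\{f\in H: f(z_1)=\dots=f(z_n)=0\}$ of $H$ onto $H(\sigma)$. Evaluations on $H(\sigma)$ are continuous and $\mathcal K_z$ denotes its evaluator at $z$. For a function $g$, $g^*(w)=\overline{g(\overline w)}$. In the first determinant the $k$-th row ($k=1,\dots,n+1$) has entries $\zeta^{k-1}A(\zeta)$ if $k$ is odd and $\zeta^{k-1}B(\zeta)$ if $k$ is even, with $\zeta=z_1,\dots,z_n,w$;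 in the second determinant the roles of $A$ and $B$ are exchanged. *)

(* Defs.v *)
From HB Require Import structures.
From mathcomp Require Import all_boot all_order all_algebra complex.
From mathcomp Require Import all_classical all_reals all_analysis.

Set Implicit Arguments.
Unset Strict Implicit.
Unset Printing Implicit Defensive.

Import Order.TTheory GRing.Theory Num.Theory.
Import numFieldNormedType.Exports.

Local Open Scope classical_set_scope.
Local Open Scope ring_scope.

(* The topology of the complex numbers R[i] is carried by its alias R[i]^o. *)

Definition entire (R : realType) (f : R[i] -> R[i]) : Prop :=
  forall z : R[i], derivable (f : R[i]^o -> R[i]^o) z 1.

Definition real_on_reals (R : realType) (f : R[i] -> R[i]) : Prop :=
  forall x : R, f x%:C%C \is Num.real.

Definition even_fun (R : realType) (f : R[i] -> R[i]) : Prop :=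
  forall w, f (- w) = f w.

Definition odd_fun (R : realType) (f : R[i] -> R[i]) : Prop :=
  forall w, f (- w) = - f w.

Definition star (R : realType) (f : R[i] -> R[i]) : R[i] -> R[i] :=
  fun w => (f w^*)^*.

(* f with its values on S replaced by its limits; S is meant to contain the
   points where the expression defining f divides by zero. *)
Definition by_continuity (R : realType) (S : set R[i]) (f : R[i] -> R[i]) :
    R[i] -> R[i] :=
  fun w => if w \in S then lim ((f : R[i]^o -> R[i]^o) @ (w : R[i]^o)^')
           else f w.

(* A set of functions together with a candidate scalar product; the values of
   ip outside the carrier are irrelevant. *)
Record fun_space (R : realType) := FunSpace {
  carrier : set (R[i] -> R[i]);
  ip : (R[i] -> R[i]) -> (R[i] -> R[i]) -> R[i] }.

Definition ipnorm (R : realType) (H : fun_space R) (f : R[i] -> R[i]) : R[i] :=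
  sqrtC (ip H f f).

Record hilbert_of_entire (R : realType) (H : fun_space R) : Prop := {
  hoe_zero : carrier H (fun=> 0);
  hoe_lin : forall a f g, carrier H f -> carrier H g ->
    carrier H (fun w => a * f w + g w);
  hoe_ip_linear_r : forall a f g h,
    carrier H f -> carrier H g -> carrier H h ->
    ip H h (fun w => a * f w + g w) = a * ip H h f + ip H h g;
  hoe_ip_conj : forall f g, carrier H f -> carrier H g ->
    ip H g f = (ip H f g)^*;
  hoe_ip_ge0 : forall f, carrier H f -> 0 <= ip H f f;
  hoe_ip_eq0 : forall f, carrier H f -> ip H f f = 0 -> f = (fun=> 0);
  hoe_complete : forall u : nat -> R[i] -> R[i],
    (forall m, carrier H (u m)) ->
    (forall e : R[i], 0 < e -> exists N, forall m k, (N <= m)%N -> (N <= k)%N ->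
       ipnorm H (fun w => u m w - u k w) < e) ->
    exists2 f, carrier H f &
      forall e : R[i], 0 < e -> exists N, forall m, (N <= m)%N ->
        ipnorm H (fun w => u m w - f w) < e;
  hoe_entire : forall f, carrier H f -> entire f;
  hoe_eval_continuous : forall z f, carrier H f ->
    forall e : R[i], 0 < e -> exists2 d : R[i], 0 < d &
      forall g, carrier H g -> ipnorm H (fun w => g w - f w) < d ->
        `|g z - f z| < e }.

Definition is_evaluator (R : realType) (H : fun_space R) (z : R[i])
    (k : R[i] -> R[i]) : Prop :=
  carrier H k /\ forall f, carrier H f -> f z = ip H k f.

(* As a function of w, at fixed z. *)
Definition kernel_of (R : realType) (A B : R[i] -> R[i]) (z : R[i]) :
    R[i] -> R[i] :=
  by_continuity [set z^*]
    (fun w => 2 * (((B z)^* * A w - (A z)^* * B w) / (z^* - w))).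

Definition lin_independent (R : realType) (n : nat)
    (v : 'I_n -> R[i] -> R[i]) : Prop :=
  forall c : 'I_n -> R[i],
    (forall w, \sum_i c i * v i w = 0) -> forall i, c i = 0.

Definition gamma (R : realType) (n : nat) (s : 'I_n -> R[i]) : R[i] -> R[i] :=
  fun z => \prod_i (z - s i)^-1.

Definition mul_gamma (R : realType) (n : nat) (s : 'I_n -> R[i])
    (f : R[i] -> R[i]) : R[i] -> R[i] :=
  by_continuity (range s) (fun z => gamma s z * f z).

(* H(sigma). On functions vanishing at the points of s, multiplication by
   prod_i (z - s i) inverts mul_gamma s, so ip is the scalar product
   transported from H. *)
Definition Hsigma (R : realType) (H : fun_space R) (n : nat)
    (s : 'I_n -> R[i]) : fun_space R :=
  FunSpace
    (mul_gamma s @` [set f | carrier H f /\ forall i, f (s i) = 0])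
    (fun g1 g2 => ip H (fun z => (\prod_i (z - s i)) * g1 z)
                       (fun z => (\prod_i (z - s i)) * g2 z)).

(* Rows are numbered from 0, so A sits on the even-numbered ones. *)
Definition alt_matrix (R : realType) (A B : R[i] -> R[i]) (m : nat)
    (x : 'I_m -> R[i]) : 'M[R[i]]_m :=
  \matrix_(k, j) (x j ^+ k * (if odd k then B (x j) else A (x j))).

(* The sequence (s_1, ..., s_n, w). *)
Definition append_pt (R : realType) (n : nat) (s : 'I_n -> R[i]) (w : R[i]) :
    'I_n.+1 -> R[i] :=
  fun j => if unlift ord_max j is Some i then s i else w.

(* The upper left n x n block of alt_matrix A B (append_pt s w) is
   alt_matrix A B s. *)
Definition det_quotient (R : realType) (A B : R[i] -> R[i]) (n : nat)
    (s : 'I_n -> R[i]) (w : R[i]) : R[i] :=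
  gamma s w * star (gamma s) w / \det (alt_matrix A B s)
    * \det (alt_matrix A B (append_pt s w)).

Definition poles (R : realType) (n : nat) (s : 'I_n -> R[i]) : set R[i] :=
  range s `|` range (fun i => (s i)^*).

Definition calA (R : realType) (A B : R[i] -> R[i]) (n : nat)
    (s : 'I_n -> R[i]) : R[i] -> R[i] :=
  by_continuity (poles s)
    (fun w => (-1) ^+ ((n * n.-1)./2) * det_quotient A B s w).

Definition calB (R : realType) (A B : R[i] -> R[i]) (n : nat)
    (s : 'I_n -> R[i]) : R[i] -> R[i] :=
  by_continuity (poles s)
    (fun w => (-1) ^+ ((n * n.+1)./2) * det_quotient B A s w).

(* Main.v *)
Require Import Defs.
From HB Require Import structures.
From mathcomp Require Import all_boot all_order all_algebra complex.
From mathcomp Require Import all_classical all_reals all_analysis.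
From mathcomp Require Import ring lra.

(** Write P(w) = prod_i (w - s_i) and Q(w) = prod_i (w + s_i).  The points s_i
    are imaginary, so s_i^* = - s_i and gamma(w) gamma^*(w) = 1 / (P Q)(w).
    Division of an entire function by its zeros shows that H(sigma) is the space
    of the entire F with P F in H (Hsigma_carrier).  The evaluator of H(sigma)
    at z is thus the function K_z with P K_z in H and (P K_z, P F) = F(z), and
    the theorem says that the kernel built on calA and calB is this K_z.

    Expansion along the last column gives P Q calA = a1 A + b1 B and
    P Q calB = a2 B + b2 A, with a1, a2 even and b1, b2 odd polynomials of degree
    at most n.  The left sides vanish at the s_i, where two columns agree, hence
    by parity at all the points +-s_i, so the poles are removable.  As (A, B)
    has no zero at these points, the polynomial a1 a2 - b1 b2 vanishes at the 2n
    points too; the division by det U_n and det V_n and the signs make it monic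
    of degree 2n, so that a1 a2 - b1 b2 = P Q (delta_prod).

    Let u = z^*.  Then P Q(w) (calB(u) calA(w) - calA(u) calB(w)) has the form
    q(w) A(w) + r(w) B(w) with q, r of degree at most n, it vanishes at the - s_i,
    and the identity above gives q(u) = B(u), r(u) = - A(u).  Lagrange
    interpolation at u, - s_1, ..., - s_n (comb_span) turns this into the
    statement that P K_z is the sum of (1 / P(z))^* Z_z and of a combination of
    the Z_(s_i).  The latter are orthogonal to every P F, whence
    (P K_z, P F) = F(z) (kernel_regular).  This needs z to be none of the +-s_i;
    those points, which are not real, are reached by a limit, since the norm of
    P K_z - P K_z' is expressed by values of the kernel and the kernel is
    continuous there (reproducing_limit, kernel_pole).

    The same interpolation proves that det U_n and det V_n are not zero: if
    q A + r B vanishes at all +-s_i with q and r of degree less than n, then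
    (q A + r B) / Q is a combination of the Z_(s_i) which vanishes at the s_j, so
    it is orthogonal to itself, and by independence q = r = 0 (AB_free).  By this
    uniqueness the coefficients of a1, b1, a2, b2 are also real.

    Since entire only means differentiable everywhere, two facts of function
    theory are needed: an entire function vanishing at a has an entire quotient
    by w - a (entire_div), and A(z^* ) = A(z)^* when A is real
    on the reals (reflection).  Both come from Cauchy's formula on a square
    (cauchy_formula), which follows from Goursat's theorem for functions that are
    continuous, and differentiable except at one point (goursat_except). *)

Set Implicit Arguments.
Unset Strict Implicit.
Unset Printing Implicit Defensive.

Import Order.TTheory GRing.Theory Num.Theory.
Import numFieldNormedType.Exports.
Import ComplexField.Normc.

Local Open Scope classical_set_scope.
Local Open Scope ring_scope.

(** * Integrals of real functions as differences of a primitive *)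

Section RealIntegral.
Context {R : realType}.
Implicit Types (u v P : R -> R) (a b x M : R).

(** The base point -2 is arbitrary: all the contours used below lie in the
    square of vertices +-1 +-i, so that it is enough to have a primitive on the
    half-line above -2. *)
Definition prim u x : R := \int[lebesgue_measure]_(t in `[-2, x]) u t.

Lemma prim_derive u x : continuous u -> -2 < x -> is_derive x 1 (prim u) (u x).
Proof.
move=> cu x2.
have ifu : lebesgue_measure.-integrable `[-2, x + 1] (EFin \o u).
  apply: continuous_compact_integrable; first exact: segment_compact.
  exact: continuous_subspaceT.
have x1 : x < x + 1 by rewrite ltrDl.
have [d e] := continuous_FTC1_closed x1 ifu x2 (cu x).
split; first exact: d.
by rewrite -derive1E e.
Qed.

Definition rint u a b := prim u b - prim u a.

Lemma MVT_above P u a b : -2 < a -> a <= b ->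
  (forall x, -2 < x -> is_derive x 1 P (u x)) ->
  exists2 c, a <= c <= b & P b - P a = u c * (b - a).
Proof.
move=> a2 ab dP.
have [||c cab e] := @MVT_segment R P u a b ab.
- by move=> x; rewrite in_itv /= => /andP[ax _]; apply: dP; lra.
- apply: derivable_within_continuous => x; rewrite in_itv /= => /andP[ax _].
  by have [|//] := dP x _; lra.
by exists c => //; move: cab; rewrite in_itv.
Qed.

(** Two primitives on a half-line differ by a constant, so any primitive
    computes the integral. Linearity and explicit values all come from here. *)
Lemma rint_prim u P a b : continuous u -> -2 < a -> -2 < b ->
  (forall x, -2 < x -> is_derive x 1 P (u x)) -> rint u a b = P b - P a.
Proof.
move=> cu a2 b2 dP; rewrite /rint.
have d0 x : -2 < x -> is_derive x 1 (prim u - P) ((fun=> 0) x).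
  by move=> x2; have := is_deriveB (prim_derive cu x2) (dP x x2); rewrite subrr.
have const x y : -2 < x -> x <= y -> prim u y - P y = prim u x - P x.
  move=> x2 xy; have [c _ /eqP] := MVT_above x2 xy d0.
  by rewrite mul0r subr_eq0 => /eqP.
suff : prim u b - P b = prim u a - P a by lra.
by have [ab|/ltW ba] := leP a b; [|symmetry]; apply: const.
Qed.

Lemma rint_lin u v k a b : continuous u -> continuous v -> -2 < a -> -2 < b ->
  rint (fun t => k * u t + v t) a b = k * rint u a b + rint v a b.
Proof.
move=> cu cv a2 b2.
have cuv : continuous (fun t => k * u t + v t).
  by move=> t; apply: cvgD; [apply: cvgM; [exact: cvg_cst|exact: cu]|exact: cv].
have dP x : -2 < x ->
    is_derive x 1 (fun t => k * prim u t + prim v t) (k * u x + v x).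
  move=> x2.
  exact: (is_deriveD (is_deriveZ k (prim_derive cu x2)) (prim_derive cv x2)).
by rewrite (rint_prim cuv a2 b2 dP) /rint; ring.
Qed.

Lemma rint_bound u M a b : continuous u -> -2 < a -> a <= b ->
  (forall t, a <= t <= b -> `|u t| <= M) -> `|rint u a b| <= M * (b - a).
Proof.
move=> cu a2 ab uM; rewrite /rint.
have [c cab ->] := MVT_above a2 ab (fun x => @prim_derive u x cu).
by rewrite normrM (ger0_norm (_ : 0 <= b - a)) ?subr_ge0 // ler_wpM2r ?subr_ge0 ?uM.
Qed.

Lemma rint_cst k a b : -2 < a -> -2 < b -> rint (fun=> k) a b = k * (b - a).
Proof.
move=> a2 b2; have dP x : -2 < x -> is_derive x 1 ( *%R k) k.
  move=> _; have := is_deriveZ k (is_derive_id x (1 : R)).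
  by rewrite /GRing.scale /= mulr1.
rewrite (rint_prim _ a2 b2 dP); first by ring.
by move=> x; exact: cvg_cst.
Qed.

Lemma rint_id a b : -2 < a -> -2 < b -> rint id a b = b ^+ 2 / 2 - a ^+ 2 / 2.
Proof.
move=> a2 b2.
have dP x : -2 < x -> is_derive x 1 (fun x => x ^+ 2 / 2) x.
  move=> _; have -> : (fun x : R => x ^+ 2 / 2) = 2^-1 *: (id ^+ 2 : R -> R).
    by apply/funext => y; rewrite mulrC.
  apply: is_derive_eq.
  by rewrite /GRing.scale /= expr1; field.
by rewrite (rint_prim _ a2 b2 dP) //; move=> x; exact: cvg_id.
Qed.

End RealIntegral.

(** * Complex differentiability by real inequalities *)

Section ComplexCalculus.
Context {R : realType}.
Local Open Scope complex_scope.
Local Notation C := R[i].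
Local Notation Re := (@complex.Re R).
Local Notation Im := (@complex.Im R).
Implicit Types (f g : C -> C) (z w d : C).

Lemma normE z : `|z| = (normc z)%:C :> C.
Proof. by case: z => x y; rewrite normc_def. Qed.

Lemma normc_ge0 z : 0 <= normc z.
Proof. by rewrite -lecR -normE normr_ge0. Qed.

Lemma normc_gt0 z : (0 < normc z) = (z != 0).
Proof. by rewrite -ltcR -normE normr_gt0. Qed.

Lemma normcB z w : normc (z - w) = normc (w - z).
Proof. by rewrite -opprB normcN. Qed.

Lemma posCE (e : C) : 0 < e -> 0 < Re e /\ e = (Re e)%:C.
Proof. by case: e => a b; rewrite ltcE /= => /andP[/eqP -> ->]. Qed.

Lemma normr_Re_le z : `|Re z| <= normc z.
Proof. by rewrite -lecR -normE normc_ge_Re. Qed.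

Lemma normr_Im_le z : `|Im z| <= normc z.
Proof.
have := normr_Re_le (z * 'i); rewrite ReiNIm normrN => /le_trans; apply.
by rewrite normcM /= expr0n expr1n add0r sqrtr1 mulr1.
Qed.

Lemma normc_real (x : R) : normc x%:C = `|x|.
Proof. by rewrite /= expr0n addr0 sqrtr_sqr. Qed.

Lemma normci : normc ('i : C) = 1.
Proof. by rewrite /= expr0n expr1n add0r sqrtr1. Qed.

Lemma normc_le_sum (x y : R) : normc (x +i* y) <= `|x| + `|y|.
Proof.
have -> : x +i* y = x%:C + 'i * y%:C by rewrite [LHS]complexE.
by apply: le_trans (le_normcD _ _) _; rewrite normcM normci mul1r !normc_real.
Qed.

Definition ccont f z := {for z, continuous (f : C^o -> C^o)}.

Definition cdiff f z d := forall e : R, 0 < e -> exists2 r : R, 0 < r &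
  forall w, normc (w - z) < r ->
    normc (f w - f z - d * (w - z)) <= e * normc (w - z).

Lemma ccontP f z : ccont f z <->
  forall e : R, 0 < e -> exists2 r : R, 0 < r &
    forall w, normc (w - z) < r -> normc (f w - f z) < e.
Proof.
split=> [cf e e0|H].
  have ec : 0 < e%:C :> C by rewrite ltcR.
  have /cvgrPdist_lt/(_ _ ec)/nbhs_ballP[r /= /posCE[r0 rE] zr] := cf.
  exists (Re r) => // w wz.
  rewrite -ltcR -normE distrC; apply: zr.
  by rewrite /ball /= rE normE ltcR normcB.
apply/(@cvgrPdist_lt C C^o C^o (nbhs (z : C^o)) _ f (f z)) => e /posCE[e0 ->].
have [r r0 zr] := H _ e0.
apply/nbhs_ballP; exists r%:C => /=; first by rewrite ltcR.
move=> w; rewrite /ball /= !normE !ltcR => zw.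
by rewrite normcB; apply: zr; rewrite normcB.
Qed.

Definition cderivable f z := derivable (f : C^o -> C^o) z 1.

(** Moving from limits of difference quotients, whose tolerances are positive
    elements of R[i], to inequalities between real numbers. *)
Lemma cdiffP f z : cderivable f z <-> exists d, cdiff f z d.
Proof.
split=> [|[d H]].
  rewrite /derivable => cf; exists (lim ((fun h : C^o =>
    h^-1 *: (((f : C^o -> C^o) \o shift z) (h *: 1) - f z)) @ 0^')) => e e0.
  set d := lim _.
  have ec : 0 < e%:C :> C by rewrite ltcR.
  move: cf => /cvgrPdist_le/(_ _ ec); rewrite -/d near_withinE.
  move=> /nbhs_ballP[r /= /posCE[r0 rE] zr].
  exists (Re r) => // w wz.
  have [->|wNz] := eqVneq w z.
    by rewrite !subrr mulr0 subr0 normc0 mulr0.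
  have wz0 : w - z != 0 by rewrite subr_eq0.
  have := zr (w - z); rewrite /ball /= sub0r normrN normE rE ltcR.
  move=> /(_ wz wz0); rewrite normE lecR.
  rewrite [(w - z) *: 1]mulr1 subrK => le.
  have -> : f w - f z - d * (w - z) =
      ((w - z)^-1 *: (f w - f z : C^o) - d) * (w - z).
    by rewrite mulrBl /GRing.scale /= mulrAC mulVf ?mul1r.
  by rewrite normcM ler_wpM2r ?normc_ge0 // normcB.
apply/cvg_ex; exists d; apply/cvgrPdist_le => e /posCE[e0 ->].
have [r r0 zr] := H _ e0.
rewrite near_withinE; apply/nbhs_ballP; exists r%:C => /=; first by rewrite ltcR.
move=> h; rewrite /ball /= sub0r normrN normE ltcR => hr h0.
have := zr (h + z); rewrite addrK => /(_ hr) le.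
rewrite normE lecR [h *: 1]mulr1 normcB.
have -> : h^-1 *: (f (h + z) - f z : C^o) - d
   = h^-1 * (f (h + z) - f z - d * h).
  by rewrite mulrBr mulrCA mulVf ?mulr1.
by rewrite normcM normcV mulrC ler_pdivrMr ?normc_gt0.
Qed.

Lemma ccont_cst d z : ccont (fun=> d) z.
Proof. exact: (@cst_continuous C^o C^o d). Qed.

Lemma ccont_id z : ccont id z.
Proof. by move=> A. Qed.

Lemma ccontD f g z : ccont f z -> ccont g z -> ccont (fun w => f w + g w) z.
Proof. exact: (@continuousD C C^o C^o f g z). Qed.

Lemma ccontB f g z : ccont f z -> ccont g z -> ccont (fun w => f w - g w) z.
Proof. exact: (@continuousB C C^o C^o f g z). Qed.

Lemma ccontM f g z : ccont f z -> ccont g z -> ccont (fun w => f w * g w) z.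
Proof. exact: (@continuousM C C^o f g z). Qed.

Lemma ccontV f z : f z != 0 -> ccont f z -> ccont (fun w => (f w)^-1) z.
Proof. exact: (@continuousV C C^o f z). Qed.

Lemma cderivable_cst d z : cderivable (fun=> d) z.
Proof. exact: (@derivable_cst C C^o C^o d z 1). Qed.

Lemma cderivable_id z : cderivable id z.
Proof. exact: (@derivable_id C C^o z 1). Qed.

Lemma cderivableD f g z : cderivable f z ->
  cderivable g z ->
  cderivable (fun w => f w + g w) z.
Proof. exact: (@derivableD C C^o C^o f g z 1). Qed.

Lemma cderivableB f g z : cderivable f z ->
  cderivable g z ->
  cderivable (fun w => f w - g w) z.
Proof. exact: (@derivableB C C^o C^o f g z 1). Qed.

Lemma cderivableM f g z : cderivable f z ->
  cderivable g z ->
  cderivable (fun w => f w * g w) z.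
Proof. exact: (@derivableM C C^o f g z 1). Qed.

Lemma cderivableV f z : f z != 0 -> cderivable f z ->
  cderivable (fun w => (f w)^-1) z.
Proof. exact: (@derivableV C C^o f z 1). Qed.

Lemma derivable_ccont f z : cderivable f z -> ccont f z.
Proof. by move=> /derivable1_diffP/differentiable_continuous. Qed.

Lemma near_derivable f g z (r : R) : 0 < r ->
  (forall w, normc (w - z) < r -> f w = g w) ->
  cderivable f z -> cderivable g z.
Proof.
move=> r0 fg /cdiffP[d df]; apply/cdiffP; exists d => e e0.
have [s s0 H] := df e e0.
exists (Num.min r s) => [|w]; first by rewrite lt_min r0.
rewrite lt_min => /andP[wr ws].
by rewrite -!fg ?H // subrr normc0.
Qed.

End ComplexCalculus.

(** * Integrals over the boundary of a rectangle *)

Section Contour.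
Context {R : realType}.
Local Open Scope complex_scope.
Local Notation C := R[i].
Local Notation Re := (@complex.Re R).
Local Notation Im := (@complex.Im R).
Implicit Types (f g : C -> C) (z w d k p : C) (F G : R -> C).
Implicit Types (a b x y M : R).

Definition pcont F :=
  continuous (fun t => Re (F t)) /\ continuous (fun t => Im (F t)).

Definition cint F a b : C :=
  rint (fun t => Re (F t)) a b +i* rint (fun t => Im (F t)) a b.

Lemma cint_lin F G k a b : pcont F -> pcont G -> -2 < a -> -2 < b ->
  cint (fun t => k * F t + G t) a b = k * cint F a b + cint G a b.
Proof.
case: k => k1 k2 [F1 F2] [G1 G2] a2 b2; rewrite /cint.
have -> : (fun t => Re ((k1 +i* k2) * F t + G t))
    = (fun t => k1 * Re (F t) + (- k2 * Im (F t) + Re (G t))).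
  by apply/funext => t; case: (F t) (G t) => [? ?] [? ?] /=; ring.
have -> : (fun t => Im ((k1 +i* k2) * F t + G t))
    = (fun t => k1 * Im (F t) + (k2 * Re (F t) + Im (G t))).
  by apply/funext => t; case: (F t) (G t) => [? ?] [? ?] /=; ring.
have lin (u v : R -> R) (l : R) : continuous u -> continuous v ->
    continuous (fun t => l * u t + v t).
  by move=> cu cv t; apply: cvgD; [apply: cvgM; [exact: cvg_cst|exact: cu]|exact: cv].
rewrite !rint_lin //; try exact: lin.
by apply/eqP; rewrite eq_complex /=; apply/andP; split; apply/eqP; ring.
Qed.

(** The factor 2 comes from bounding real and imaginary parts separately. It is
    harmless: only the order of magnitude of contour integrals is used. *)
Lemma cint_bound F M a b : pcont F -> -2 < a -> a <= b ->
  (forall t, a <= t <= b -> normc (F t) <= M) ->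
  normc (cint F a b) <= 2 * M * (b - a).
Proof.
move=> [F1 F2] a2 ab FM; apply: (le_trans (normc_le_sum _ _)).
have := @rint_bound _ _ M a b F1 a2 ab _.
have := @rint_bound _ _ M a b F2 a2 ab _.
move=> /(_ (fun t h => le_trans (normr_Im_le _) (FM t h))) h1.
move=> /(_ (fun t h => le_trans (normr_Re_le _) (FM t h))) h2.
lra.
Qed.

(** Paths of this kind preserve continuity; the sides of a rectangle are the
    only ones that occur. *)
Definition short (phi : R -> C) := forall s t, normc (phi s - phi t) <= `|s - t|.

Lemma short_h y : short (fun t => t +i* y).
Proof.
move=> s t; have -> : (s +i* y) - (t +i* y) = (s - t)%:C :> C.
  by apply/eqP; rewrite eq_complex /= subrr !eqxx.
by rewrite normc_real.
Qed.

Lemma short_v x : short (fun t => x +i* t).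
Proof.
move=> s t; have -> : (x +i* s) - (x +i* t) = 'i * (s - t)%:C :> C.
  by apply/eqP; rewrite eq_complex /=; apply/andP; split; apply/eqP; ring.
by rewrite normcM normci mul1r normc_real.
Qed.

Lemma pcont_comp g phi : short phi -> (forall t, ccont g (phi t)) ->
  pcont (fun t => g (phi t)).
Proof.
move=> sp cg; split => t; apply/cvgrPdist_lt => e e0;
  have [r r0 H] := (ccontP _ _).1 (cg t) _ e0;
  apply/nbhs_ballP; exists r => //= s; rewrite /ball /= distrC => st;
  have := H _ (le_lt_trans (sp s t) st); rewrite normcB; apply: le_lt_trans.
- by have := normr_Re_le (g (phi t) - g (phi s)); rewrite raddfB.
- by have := normr_Im_le (g (phi t) - g (phi s)); rewrite raddfB.
Qed.

(** Whole lines rather than sides: the primitives are taken on lines. *)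
Definition frame x0 x1 y0 y1 z :=
  (Re z == x0) || (Re z == x1) || (Im z == y0) || (Im z == y1).

Definition inrect x0 x1 y0 y1 z := (x0 <= Re z <= x1) && (y0 <= Im z <= y1).

Definition rectint g x0 x1 y0 y1 : C :=
  cint (fun t => g (t +i* y0)) x0 x1 + 'i * cint (fun t => g (x1 +i* t)) y0 y1
  - cint (fun t => g (t +i* y1)) x0 x1 - 'i * cint (fun t => g (x0 +i* t)) y0 y1.

Definition boundary_sum (h v : R -> R -> C) x0 x1 y0 y1 : C :=
  (h y0 x1 - h y0 x0) + 'i * (v x1 y1 - v x1 y0)
  - (h y1 x1 - h y1 x0) - 'i * (v x0 y1 - v x0 y0).

(** Once the integrals on horizontal and vertical lines are written with
    primitives, the cutting of rectangles is an identity of finite sums. *)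
Lemma rectintE g : exists h v : R -> R -> C, rectint g = boundary_sum h v.
Proof.
pose prc F x : C := prim (fun t => Re (F t)) x +i* prim (fun t => Im (F t)) x.
by exists (fun y => prc (fun t => g (t +i* y))), (fun x => prc (fun t => g (x +i* t))).
Qed.

Lemma frame_pcont g x0 x1 y0 y1 :
  (forall z, frame x0 x1 y0 y1 z -> ccont g z) ->
  [/\ pcont (fun t => g (t +i* y0)), pcont (fun t => g (t +i* y1)),
      pcont (fun t => g (x0 +i* t)) & pcont (fun t => g (x1 +i* t))].
Proof.
move=> cg.
by split; [apply: (pcont_comp (short_h y0))|apply: (pcont_comp (short_h y1))
  |apply: (pcont_comp (short_v x0))|apply: (pcont_comp (short_v x1))] => t;
  apply: cg; rewrite /frame /= eqxx ?orbT.
Qed.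

Lemma rectint_lin f g k x0 x1 y0 y1 :
  -2 < x0 -> -2 < x1 -> -2 < y0 -> -2 < y1 ->
  (forall z, frame x0 x1 y0 y1 z -> ccont f z) ->
  (forall z, frame x0 x1 y0 y1 z -> ccont g z) ->
  rectint (fun z => k * f z + g z) x0 x1 y0 y1
  = k * rectint f x0 x1 y0 y1 + rectint g x0 x1 y0 y1.
Proof.
move=> ? ? ? ? /frame_pcont[? ? ? ?] /frame_pcont[? ? ? ?].
by rewrite /rectint !cint_lin //; ring.
Qed.

Lemma rectint_bound g M x0 x1 y0 y1 :
  -2 < x0 -> x0 <= x1 -> -2 < y0 -> y0 <= y1 ->
  (forall z, frame x0 x1 y0 y1 z -> ccont g z) ->
  (forall z, frame x0 x1 y0 y1 z -> inrect x0 x1 y0 y1 z -> normc (g z) <= M) ->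
  normc (rectint g x0 x1 y0 y1) <= 4 * M * ((x1 - x0) + (y1 - y0)).
Proof.
move=> x02 x01 y02 y01 /frame_pcont[c1 c2 c3 c4] gM.
have b1 : normc (cint (fun t => g (t +i* y0)) x0 x1) <= 2 * M * (x1 - x0).
  apply: cint_bound => // t tt; apply: gM; first by rewrite /frame /= eqxx ?orbT.
  by rewrite /inrect /= tt lexx y01.
have b2 : normc (cint (fun t => g (t +i* y1)) x0 x1) <= 2 * M * (x1 - x0).
  apply: cint_bound => // t tt; apply: gM; first by rewrite /frame /= eqxx ?orbT.
  by rewrite /inrect /= tt lexx y01.
have b3 : normc (cint (fun t => g (x0 +i* t)) y0 y1) <= 2 * M * (y1 - y0).
  apply: cint_bound => // t tt; apply: gM; first by rewrite /frame /= eqxx ?orbT.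
  by rewrite /inrect /= tt lexx x01.
have b4 : normc (cint (fun t => g (x1 +i* t)) y0 y1) <= 2 * M * (y1 - y0).
  apply: cint_bound => // t tt; apply: gM; first by rewrite /frame /= eqxx ?orbT.
  by rewrite /inrect /= tt lexx x01.
rewrite /rectint; move: b1 b2 b3 b4.
move: (cint (fun t => g (t +i* y0)) _ _) => I1.
move: (cint (fun t => g (t +i* y1)) _ _) => I2.
move: (cint (fun t => g (x0 +i* t)) _ _) => I3.
move: (cint (fun t => g (x1 +i* t)) _ _) => I4.
move=> b1 b2 b3 b4.
have n1 := le_normcD (I1 + 'i * I4 - I2) (- ('i * I3)).
have n2 := le_normcD (I1 + 'i * I4) (- I2).
have n3 := le_normcD I1 ('i * I4).
rewrite !(normcN, normcM, normci, mul1r) in n1 n2 n3.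
lra.
Qed.

(** Affine functions have primitives; these are the functions that Goursat's
    argument subtracts. *)
Lemma rectint_affine k d x0 x1 y0 y1 :
  -2 < x0 -> -2 < x1 -> -2 < y0 -> -2 < y1 ->
  rectint (fun z => k * z + d) x0 x1 y0 y1 = 0.
Proof.
move=> ? ? ? ?; rewrite rectint_lin //; first last.
- by move=> z _; apply: ccont_cst.
- by move=> z _; apply: ccont_id.
rewrite /rectint /cint /= !rint_cst // !rint_id //.
case: k d => [k1 k2] [d1 d2]; apply/eqP; rewrite eq_complex /=.
by apply/andP; split; apply/eqP; field.
Qed.

Lemma eq_rectint f g x0 x1 y0 y1 : (forall z, frame x0 x1 y0 y1 z -> f z = g z) ->
  rectint f x0 x1 y0 y1 = rectint g x0 x1 y0 y1.
Proof.
move=> fg.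
have e (phi : R -> C) : (forall t, frame x0 x1 y0 y1 (phi t)) ->
    (fun t => f (phi t)) = (fun t => g (phi t)).
  by move=> h; apply/funext => t; apply: fg.
by rewrite /rectint !e // => t; rewrite /frame /= eqxx ?orbT.
Qed.

End Contour.

(** * Goursat's theorem *)

Section Goursat.
Context {R : realType}.
Local Open Scope complex_scope.
Local Notation C := R[i].
Local Notation Re := (@complex.Re R).
Local Notation Im := (@complex.Im R).
Implicit Types (f g : C -> C) (z w d k p : C).

Lemma small_pow2 (M r : R) : 0 < r -> exists n : nat, M / 2 ^+ n < r.
Proof.
move=> r0; exists (Num.bound (`|M| / r)).
have bd : 0 <= `|M| / r by rewrite divr_ge0 // ltW.
rewrite ltr_pdivrMr ?exprn_gt0 //.
apply: le_lt_trans (ler_norm M) _; rewrite -ltr_pdivrMl // mulrC.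
apply: lt_trans (archi_boundP bd) _.
by rewrite -natrX ltr_nat ltn_expl.
Qed.

(** The corners increase and the opposite corners decrease, so the supremum of
    the corners lies in all the intervals. *)
Lemma nested_halving (a : nat -> R) (w : R) : 0 <= w ->
  (forall n, a n <= a n.+1 <= a n + w / 2 ^+ n.+1) ->
  exists p : R, forall n, a n <= p <= a n + w / 2 ^+ n.
Proof.
move=> w0 aS.
have up : {homo a : m n / (m <= n)%N >-> m <= n}.
  by apply: homo_leq => // [x y z|n]; [exact: le_trans|have /andP[] := aS n].
pose c n := a n + w / 2 ^+ n.
have down : {homo c : m n / (m <= n)%N >-> n <= m}.
  apply: homo_leq => // [x y z h1 h2|n]; first exact: le_trans h2 h1.
  rewrite /c; have /andP[_ h] := aS n; apply: le_trans (lerD h (lexx _)) _.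
  by rewrite -addrA lerD2l exprS invfM; lra.
have ac m n : a m <= c n.
  have a_le_c j : a j <= c j by rewrite lerDl divr_ge0 // exprn_ge0.
  have [mn|/ltnW nm] := leqP m n; first exact: le_trans (up _ _ mn) (a_le_c n).
  exact: le_trans (a_le_c m) (down _ _ nm).
exists (sup (range a)) => n; apply/andP; split.
  apply: ub_le_sup; last by exists n.
  by exists (c 0%N) => _ [m _ <-].
apply: ge_sup; first by exists (a 0%N); exists 0%N.
by move=> _ [m _ <-]; exact: ac.
Qed.

Lemma rectint_quarter g (a b w h : R) :
  rectint g a (a + w) b (b + h) =
    (rectint g a (a + w / 2) b (b + h / 2) +
     rectint g (a + w / 2) (a + w / 2 + w / 2) b (b + h / 2)) +
    (rectint g a (a + w / 2) (b + h / 2) (b + h / 2 + h / 2) +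
     rectint g (a + w / 2) (a + w / 2 + w / 2) (b + h / 2) (b + h / 2 + h / 2)).
Proof.
have e (x y : R) : x + y / 2 + y / 2 = x + y by field.
by have [hor [ver ->]] := rectintE g; rewrite !e /boundary_sum; ring.
Qed.

(** Subtracting the affine approximation at p does not change the integral, and
    the remainder is at most e / 8 times the distance to p near p. *)
Lemma goursat_local g p (e : R) : 0 < e -> -1 <= Re p -> -1 <= Im p ->
  (forall z, ccont g z) -> cderivable g p ->
  exists2 r : R, 0 < r &
    forall a b w h : R, -2 < a -> -2 < b -> 0 <= w -> 0 <= h ->
    a <= Re p <= a + w -> b <= Im p <= b + h -> w + h < r ->
    normc (rectint g a (a + w) b (b + h)) <= e * (w ^+ 2 + h ^+ 2).
Proof.
move=> e0 p1 p2 cg /cdiffP[d dg].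
have [|r r0 H] := dg (e / 8); first by lra.
exists r => // a b w h a2 b2 w0 h0 /andP[ap pa] /andP[bp pb] wr.
pose E z := g z - (d * z + (g p - d * p)).
have cE z : ccont E z.
  apply: ccontB => //; apply: ccontD; last exact: ccont_cst.
  by apply: ccontM; [exact: ccont_cst|exact: ccont_id].
have -> : rectint g a (a + w) b (b + h) = rectint E a (a + w) b (b + h).
  have -> : E = (fun z => -1 * (d * z + (g p - d * p)) + g z).
    by apply/funext => z; rewrite /E; ring.
  rewrite rectint_lin ?rectint_affine ?mulr0 ?add0r //; try lra.
  move=> z _; apply: ccontD; last exact: ccont_cst.
  by apply: ccontM; [exact: ccont_cst|exact: ccont_id].
have Eb z : inrect a (a + w) b (b + h) z -> normc (E z) <= e / 8 * (w + h).
  move=> /andP[/andP[az za] /andP[bz zb]].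
  have zp : normc (z - p) <= w + h.
    have := normc_le_sum (Re (z - p)) (Im (z - p)).
    have -> : Re (z - p) +i* Im (z - p) = z - p by case: (z - p).
    move=> /le_trans; apply; rewrite !raddfB /=.
    by apply: lerD; rewrite ler_norml; apply/andP; split; lra.
  have := H z (le_lt_trans zp wr).
  have -> : g z - g p - d * (z - p) = E z by rewrite /E; ring.
  move=> /le_trans; apply; rewrite ler_wpM2l //; lra.
apply: le_trans.
  apply: (@rectint_bound _ E (e / 8 * (w + h))) => //; try lra.
  by move=> z _ /Eb.
have -> : e * (w ^+ 2 + h ^+ 2) = e / 2 * (w + h) ^+ 2 + e / 2 * (w - h) ^+ 2.
  by field.
have : 0 <= e / 2 * (w - h) ^+ 2 by rewrite mulr_ge0 ?sqr_ge0 //; lra.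
have -> : 4 * (e / 8 * (w + h)) * (a + w - a + (b + h - b)) = e / 2 * (w + h) ^+ 2.
  by field.
lra.
Qed.

(** Comparing the integral with w^2 + h^2 makes the estimate exactly additive
    under cutting in four. If it failed for the rectangle, it would fail for one
    of the quarters, and so on down to a point, against goursat_local. *)
Lemma goursat_rect g (a b w h : R) : -1 <= a -> -1 <= b -> 0 <= w -> 0 <= h ->
  (forall z, ccont g z) ->
  (forall z, inrect a (a + w) b (b + h) z -> cderivable g z) ->
  rectint g a (a + w) b (b + h) = 0.
Proof.
move=> a1 b1 w0 h0 cg dg.
apply: contrapT => N0.
have [e e0 bad0] : exists2 e : R, 0 < e &
    e * (w ^+ 2 + h ^+ 2) < normc (rectint g a (a + w) b (b + h)).
  have n0 : 0 < normc (rectint g a (a + w) b (b + h)).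
    by rewrite normc_gt0; apply/eqP.
  have s0 : 0 <= w ^+ 2 + h ^+ 2 by rewrite addr_ge0 ?sqr_ge0.
  exists (normc (rectint g a (a + w) b (b + h)) / (w ^+ 2 + h ^+ 2 + 1)).
    by rewrite divr_gt0 // ltr_wpDl.
  rewrite mulrAC ltr_pdivrMr ?ltr_wpDl //.
  by rewrite ltr_pM2l // ltrDl.
pose bad (t : R * R * R * R) := let: (a, b, w, h) := t in
  e * (w ^+ 2 + h ^+ 2) < normc (rectint g a (a + w) b (b + h)).
pose sub (s t : R * R * R * R) :=
  let: (a, b, w, h) := s in let: (a', b', w', h') := t in
  [/\ w' = w / 2, h' = h / 2, (a' == a) || (a' == a + w / 2) &
      (b' == b) || (b' == b + h / 2)].
have step s : exists t, bad s -> bad t /\ sub s t.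
  have [bs|nbs] := pselect (bad s); last by exists s.
  apply: contrapT => Nt.
  case: s bs Nt => [[[x y] u] v] + Nt; rewrite {1}/bad rectint_quarter => bs.
  have ok x' y' : (x' == x) || (x' == x + u / 2) -> (y' == y) || (y' == y + v / 2) ->
      normc (rectint g x' (x' + u / 2) y' (y' + v / 2))
        <= e * ((u / 2) ^+ 2 + (v / 2) ^+ 2).
    move=> hx hy; rewrite leNgt; apply/negP => lt; apply: Nt.
    by exists (x', y', u / 2, v / 2).
  have o1 := ok x y; have o2 := ok (x + u / 2) y.
  have o3 := ok x (y + v / 2); have o4 := ok (x + u / 2) (y + v / 2).
  move: o1 o2 o3 o4; rewrite !eqxx ?orbT.
  move=> /(_ isT isT) o1 /(_ isT isT) o2 /(_ isT isT) o3 /(_ isT isT) o4.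
  have := lt_le_trans bs (le_normcD _ _).
  set z1 := rectint _ _ _ _ _ in o1 *; set z2 := rectint _ _ _ _ _ in o2 *.
  set z3 := rectint _ _ _ _ _ in o3 *; set z4 := rectint _ _ _ _ _ in o4 *.
  have n1 := le_normcD z1 z2; have n2 := le_normcD z3 z4.
  lra.
have [next nextP] := choice step.
pose t n := iter n next (a, b, w, h).
have t0 : t 0%N = (a, b, w, h) by [].
have tS n : bad (t n) -> bad (t n.+1) /\ sub (t n) (t n.+1) by exact: nextP.
pose A n := (t n).1.1.1; pose B n := (t n).1.1.2.
have inv n : t n = (A n, B n, w / 2 ^+ n, h / 2 ^+ n) /\ bad (t n).
  elim: n => [|n [tn bn]].
    by split; [rewrite /A /B t0 /= expr0 !divr1|].
  rewrite /A /B; have [] := tS n bn; rewrite {1}tn /sub.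
  case: (t n.+1) => [[[x y] u] v] bS [eu ev _ _]; split; last exact: bS.
  rewrite eu ev.
  by rewrite exprSr !invfM !mulrA.
have AB n : ((A n.+1 == A n) || (A n.+1 == A n + w / 2 ^+ n.+1)) /\
            ((B n.+1 == B n) || (B n.+1 == B n + h / 2 ^+ n.+1)).
  have [tn bn] := inv n; have [_] := tS n bn; rewrite /A /B {1}tn /sub.
  case: (t n.+1) => [[[x y] u] v] [_ _ eA eB] /=.
  by rewrite !exprSr !invfM !mulrA.
have [|p1 hp1] := @nested_halving A w w0.
  move=> n; have [/orP[/eqP->|/eqP->] _] := AB n; rewrite lexx /= ?andbT ?lerDl;
  by rewrite divr_ge0 // exprn_ge0.
have [|p2 hp2] := @nested_halving B h h0.
  move=> n; have [_ /orP[/eqP->|/eqP->]] := AB n; rewrite lexx /= ?andbT ?lerDl;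
  by rewrite divr_ge0 // exprn_ge0.
have A0 : A 0%N = a by rewrite /A t0.
have B0 : B 0%N = b by rewrite /B t0.
have := hp1 0%N; have := hp2 0%N; rewrite A0 B0 expr0 !divr1.
move=> /andP[bp pb] /andP[ap pa].
have [|||r r0 H] := @goursat_local g (p1 +i* p2) e e0 _ _ cg.
- by rewrite /=; lra.
- by rewrite /=; lra.
- by apply: dg; rewrite /inrect /= ap pa bp pb.
have [n nr] := small_pow2 (w + h) r0.
have [tn bn] := inv n; move: bn; rewrite tn /bad => /lt_geF/negP; apply.
have aA m : a <= A m.
  elim: m => [|m IH]; first by rewrite A0.
  have [/orP[/eqP->|/eqP->] _] := AB m => //; apply: le_trans IH _.
  by rewrite lerDl divr_ge0 // exprn_ge0.
have bB m : b <= B m.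
  elim: m => [|m IH]; first by rewrite B0.
  have [_ /orP[/eqP->|/eqP->]] := AB m => //; apply: le_trans IH _.
  by rewrite lerDl divr_ge0 // exprn_ge0.
apply: H; rewrite ?divr_ge0 ?exprn_ge0 //=; try exact: hp1; try exact: hp2.
- by have := aA n; lra.
- by have := bB n; lra.
- by rewrite -mulrDl.
Qed.

End Goursat.

(** * The unit square and an exceptional point *)

Section Cauchy.
Context {R : realType}.
Local Open Scope complex_scope.
Local Notation C := R[i].
Local Notation Re := (@complex.Re R).
Local Notation Im := (@complex.Im R).
Implicit Types (f g phi : C -> C) (z w d k p : C).

Lemma goursat g (x0 x1 y0 y1 : R) : -1 <= x0 -> x0 <= x1 -> -1 <= y0 -> y0 <= y1 ->
  (forall z, ccont g z) ->
  (forall z, inrect x0 x1 y0 y1 z -> cderivable g z) ->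
  rectint g x0 x1 y0 y1 = 0.
Proof.
move=> x01 x1x y01 y1y cg; have := @goursat_rect _ g x0 y0 (x1 - x0) (y1 - y0).
by rewrite !(addrC _ (_ - _)) !subrK !subr_ge0 => H; apply: H.
Qed.

(** The rectangle is cut into two vertical strips, and the middle strip into
    three pieces; the last piece will be a small square around an exceptional
    point. *)
Lemma rectint_frame g (x0 x1 y0 y1 a b c d : R) :
  rectint g x0 x1 y0 y1 = rectint g x0 a y0 y1 + rectint g b x1 y0 y1
    + rectint g a b y0 c + rectint g a b d y1 + rectint g a b c d.
Proof.
by have [hor [ver ->]] := rectintE g; rewrite /boundary_sum; ring.
Qed.

Definition square_int g : C := rectint g (-1) 1 (-1) 1.

Definition on_square z := frame (-1) 1 (-1) 1 z && inrect (-1) 1 (-1) 1 z.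

(** Only a small square around p contributes. There g is bounded, by continuity,
    so the contribution is at most a constant times the side. *)
Lemma goursat_except g p : normc p < 1 -> (forall z, ccont g z) ->
  (forall z, z != p -> cderivable g z) -> square_int g = 0.
Proof.
move=> p1 cg dg.
have hRe : `|Re p| < 1 by apply: le_lt_trans p1; exact: normr_Re_le.
have hIm : `|Im p| < 1 by apply: le_lt_trans p1; exact: normr_Im_le.
have [r r0 H] := (ccontP _ _).1 (cg p) 1 ltr01.
apply: contrapT => /eqP; rewrite -normc_gt0; set N := normc _ => N0.
pose M := normc (g p) + 1.
have M0 : 0 < M by rewrite ltr_wpDl ?normc_ge0.
(* Half the side of the small square: it has to fit in the unit square and in
   the disc where g is bounded by M, and to make 16 M e smaller than N. *)
pose e := Num.min (Num.min (1 - `|Re p|) (1 - `|Im p|)) (Num.min (r / 4) (N / (32 * M))).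
have e0 : 0 < e.
  by rewrite !lt_min !subr_gt0 hRe hIm !divr_gt0 // ?mulr_gt0.
have [e1 e2 e3 e4] : [/\ e <= 1 - `|Re p|, e <= 1 - `|Im p|, e <= r / 4 & e <= N / (32 * M)].
  by split; rewrite !ge_min lexx ?orbT.
have [a1 a2] : - `|Re p| <= Re p /\ Re p <= `|Re p|.
  by split; [rewrite lerNl -normrN ler_norm|rewrite ler_norm].
have [b1 b2] : - `|Im p| <= Im p /\ Im p <= `|Im p|.
  by split; [rewrite lerNl -normrN ler_norm|rewrite ler_norm].
have zero (x0 x1 y0 y1 : R) : -1 <= x0 -> x0 <= x1 -> -1 <= y0 -> y0 <= y1 ->
    ~~ inrect x0 x1 y0 y1 p -> rectint g x0 x1 y0 y1 = 0.
  move=> *; apply: goursat => // z zin; apply: dg.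
  by apply/negP => /eqP zp; move: zin; rewrite zp; apply/negP.
have NE : square_int g = rectint g (Re p - e) (Re p + e) (Im p - e) (Im p + e).
  rewrite /square_int (@rectint_frame _ _ _ _ _ (Re p - e) (Re p + e) (Im p - e) (Im p + e)).
  set mid := rectint g (Re p - e) (Re p + e) (Im p - e) (Im p + e).
  rewrite !zero ?add0r //; try lra;
  by rewrite /inrect; apply/negP => /andP[/andP[h1 h2] /andP[h3 h4]]; lra.
have : N <= 4 * M * ((Re p + e - (Re p - e)) + (Im p + e - (Im p - e))).
  rewrite /N NE; apply: rectint_bound => //; try lra.
  move=> z _ /andP[/andP[h1 h2] /andP[h3 h4]].
  have zp : normc (z - p) < r.
    have := normc_le_sum (Re (z - p)) (Im (z - p)).
    have -> : Re (z - p) +i* Im (z - p) = z - p by case: (z - p).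
    move=> /le_lt_trans; apply; rewrite !raddfB /=.
    have : `|Re z - Re p| <= e by rewrite ler_norml; apply/andP; split; lra.
    have : `|Im z - Im p| <= e by rewrite ler_norml; apply/andP; split; lra.
    lra.
  have := le_normcD (g z - g p) (g p); rewrite subrK => /le_trans; apply.
  by rewrite /M addrC lerD2l ltW // H.
rewrite leNgt => /negP; apply.
have : e * (32 * M) <= N by rewrite -ler_pdivlMr ?mulr_gt0.
have : 0 < e * M by rewrite mulr_gt0.
by lra.
Qed.

(** A function need only be controlled outside the open unit disc to be
    integrated over the square, and 1 / (w - z) is, for z in the disc. *)
Lemma frame_outside z : frame (-1) 1 (-1) 1 z -> 1 <= normc z.
Proof.
move=> /orP[/orP[/orP[]|]|] /eqP e.
- by apply: le_trans (normr_Re_le z); rewrite e normrN normr1.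
- by apply: le_trans (normr_Re_le z); rewrite e normr1.
- by apply: le_trans (normr_Im_le z); rewrite e normrN normr1.
- by apply: le_trans (normr_Im_le z); rewrite e normr1.
Qed.

Definition cont_outside g := forall z, 1 <= normc z -> ccont g z.

Lemma square_int_lin f g k : cont_outside f -> cont_outside g ->
  square_int (fun z => k * f z + g z) = k * square_int f + square_int g.
Proof.
move=> cf cg; rewrite /square_int rectint_lin //; try lra.
  by move=> z /frame_outside; exact: cf.
by move=> z /frame_outside; exact: cg.
Qed.

Lemma square_int_bound g (M : R) : cont_outside g ->
  (forall z, on_square z -> normc (g z) <= M) ->
  normc (square_int g) <= 16 * M.
Proof.
move=> cg gM.
have -> : 16 * M = 4 * M * ((1 - -1) + (1 - -1)) by ring.
apply: rectint_bound; try lra; first by move=> z /frame_outside; exact: cg.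
by move=> z z1 z2; apply: gM; rewrite /on_square z1.
Qed.

Lemma eq_square_int f g : (forall z, 1 <= normc z -> f z = g z) ->
  square_int f = square_int g.
Proof. by move=> fg; apply: eq_rectint => z /frame_outside; exact: fg. Qed.

Lemma on_square_bounded g : cont_outside g ->
  exists2 M : R, 0 <= M & forall z, on_square z -> normc (g z) <= M.
Proof.
move=> cg.
have path (phi : R -> C) : short phi -> (forall t, 1 <= normc (phi t)) ->
    exists2 M : R, 0 <= M & forall t, -1 <= t <= 1 -> normc (g (phi t)) <= M.
  move=> sp far.
  have c : continuous (fun t => normc (g (phi t))).
    move=> t; apply/cvgrPdist_lt => e e0.
    have [r r0 H] := (ccontP _ _).1 (cg _ (far t)) _ e0.
    apply/nbhs_ballP; exists r => //= s; rewrite /ball /= distrC => st.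
    apply: le_lt_trans (H _ (le_lt_trans (sp s t) st)).
    have n1 := le_normcD (g (phi s) - g (phi t)) (g (phi t)).
    have n2 := le_normcD (g (phi t) - g (phi s)) (g (phi s)).
    have n3 := normcB (g (phi s)) (g (phi t)).
    rewrite !subrK in n1 n2.
    by rewrite ler_norml; apply/andP; split; lra.
  have m1 : (-1 : R) <= 1 by lra.
  have [b _ hb] := EVT_max m1 (continuous_subspaceT c).
  exists (normc (g (phi b))) => [|t tt]; first exact: normc_ge0.
  by apply: hb; rewrite in_itv.
have far (x y : R) : `|x| = 1 \/ `|y| = 1 -> 1 <= normc (x +i* y).
  by move=> [<-|<-]; [exact: (normr_Re_le (x +i* y))|exact: (normr_Im_le (x +i* y))].
have n1 : `|-1 : R| = 1 by rewrite normrN normr1.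
have [||M1 M10 h1] := path (fun t => t +i* (-1)); first exact: short_h.
  by move=> t; apply: far; right.
have [||M2 M20 h2] := path (fun t => t +i* 1); first exact: short_h.
  by move=> t; apply: far; right; rewrite normr1.
have [||M3 M30 h3] := path (fun t => (-1) +i* t); first exact: short_v.
  by move=> t; apply: far; left.
have [||M4 M40 h4] := path (fun t => 1 +i* t); first exact: short_v.
  by move=> t; apply: far; left; rewrite normr1.
exists (M1 + M2 + M3 + M4); first lra.
move=> [x y] /andP[/orP[/orP[/orP[]|]|] /= /eqP -> /andP[hx hy]].
- by have := h3 y hy; lra.
- by have := h4 y hy; lra.
- by have := h1 x hx; lra.
- by have := h2 x hx; lra.
Qed.

End Cauchy.

(** * Cauchy's formula *)

Section CauchyFormula.
Context {R : realType}.
Local Open Scope complex_scope.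
Local Notation C := R[i].
Local Notation Re := (@complex.Re R).
Local Notation Im := (@complex.Im R).
Implicit Types (f g phi : C -> C) (z w d k p : C).

Definition cauchy_transform phi z := square_int (fun w => phi w * (w - z)^-1).

Lemma cont_outside_cauchy phi z : cont_outside phi -> normc z < 1 ->
  cont_outside (fun w => phi w * (w - z)^-1).
Proof.
move=> cphi z1 w w1; apply: ccontM; first exact: cphi.
apply: ccontV.
  by rewrite subr_eq0; apply/negP => /eqP wz; move: w1; rewrite wz leNgt z1.
by apply: ccontB; [exact: ccont_id|exact: ccont_cst].
Qed.

Lemma entire_ccont f z : entire f -> ccont f z.
Proof. by move=> ef; exact: (derivable_ccont (ef z)). Qed.

(** The quotient (f w - f z) / (w - z), completed by the derivative at z, is
    continuous and is differentiable except at z. The factor on the left is the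
    constant 2 i pi, but only its continuity and its value at 0 are needed. *)
Lemma cauchy_formula f z : entire f -> normc z < 1 ->
  f z * cauchy_transform (fun=> 1) z = cauchy_transform f z.
Proof.
move=> ef z1.
have [d dfz] := (cdiffP _ _).1 (ef z).
pose h w := if w == z then d else (f w - f z) * (w - z)^-1.
have hE w : w != z -> h w = (f w - f z) * (w - z)^-1 by rewrite /h => /negPf ->.
have dh w : w != z -> cderivable h w.
  move=> wz; have wz0 : w - z != 0 by rewrite subr_eq0.
  apply: (@near_derivable _ (fun w => (f w - f z) * (w - z)^-1) _ _ (normc (w - z))).
  - by rewrite normc_gt0.
  - move=> x xw; rewrite hE //; apply/negP => /eqP e.
    by move: xw; rewrite e normcB ltxx.
  apply: cderivableM.
    by apply: cderivableB; [exact: ef|exact: cderivable_cst].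
  apply: cderivableV => //.
  by apply: cderivableB; [exact: cderivable_id|exact: cderivable_cst].
have ch w : ccont h w.
  have [->|wz] := eqVneq w z; last exact/derivable_ccont/dh.
  apply/ccontP => e e0; have [|r r0 H] := dfz (e / 2); first by rewrite divr_gt0.
  exists r => // x xz.
  rewrite {2}/h eqxx; have [->|xNz] := eqVneq x z.
    by rewrite /h eqxx subrr normc0.
  have xz0 : x - z != 0 by rewrite subr_eq0.
  have := H x xz; rewrite hE //.
  have -> : f x - f z - d * (x - z) = ((f x - f z) * (x - z)^-1 - d) * (x - z).
    by rewrite mulrBl mulfVK.
  rewrite normcM ler_pM2r ?normc_gt0 // => /le_lt_trans; apply.
  by rewrite ltr_pdivrMr // mulr_natr mulr2n ltrDl.
have := goursat_except z1 ch dh.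
have c1 := @cont_outside_cauchy (fun=> 1) z (fun w _ => @ccont_cst _ 1 w) z1.
have c2 := cont_outside_cauchy (fun w _ => entire_ccont ef) z1.
rewrite (@eq_square_int _ _ (fun w => - f z * (1 * (w - z)^-1) + f w * (w - z)^-1)).
  rewrite (square_int_lin _ c1 c2) => /eqP; rewrite mulNr addrC subr_eq0 => /eqP <-.
  by rewrite /cauchy_transform.
move=> w w1; rewrite hE; last first.
  by apply/negP => /eqP wz; move: w1; rewrite wz leNgt z1.
by ring.
Qed.

Lemma on_square_outside z : on_square z -> 1 <= normc z.
Proof. by move=> /andP[/frame_outside]. Qed.

Lemma cauchy_transform_bound phi (M : R) z : cont_outside phi -> normc z < 1 / 2 ->
  (forall w, on_square w -> normc (phi w) <= M) -> 0 <= M ->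
  normc (cauchy_transform phi z) <= 32 * M.
Proof.
move=> cphi z2 phiM M0; have -> : 32 * M = 16 * (M * 2) by ring.
apply: square_int_bound => [|w sw]; first by apply: cont_outside_cauchy => //; lra.
rewrite normcM normcV ler_pM ?invr_ge0 ?normc_ge0 ?phiM //.
have w1 := on_square_outside sw.
have := le_normcD (w - z) z; rewrite subrK => h.
have h2 : 1 / 2 <= normc (w - z) by lra.
have -> : 2 = (1 / 2)^-1 :> R by field.
by rewrite lef_pV2 // posrE; lra.
Qed.

(** From 1 / (w - z) = 1 / w + z / w^2 + z^2 / (w^2 (w - z)), where the last
    term has a bounded integral for z in the half disc. *)
Lemma cauchy_transform_derivable phi : cont_outside phi ->
  cderivable (cauchy_transform phi) 0.
Proof.
move=> cphi.
have cpow n : cont_outside (fun w => phi w * w ^- n).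
  move=> w w1; apply: ccontM; first exact: cphi.
  have w0 : w != 0 by rewrite -normc_gt0; lra.
  apply: ccontV; first exact: expf_neq0.
  elim: n => [|n IH]; first exact: ccont_cst.
  have -> : (fun w : C => w ^+ n.+1) = (fun w => w * w ^+ n).
    by apply/funext => x; rewrite exprS.
  exact: (ccontM (@ccont_id _ w) IH).
have [M M0 phiM] := on_square_bounded (cpow 2%N).
apply/cdiffP; exists (square_int (fun w => phi w * w ^- 2)) => e e0.
exists (Num.min (1 / 2) (e / (32 * M + 1))) => [|z].
  by rewrite lt_min !divr_gt0 //; lra.
rewrite !subr0 lt_min => /andP[z2 ze].
have z1 : normc z < 1 by lra.
have e32 : normc (cauchy_transform (fun w => phi w * w ^- 2) z) <= 32 * M.
  exact: (cauchy_transform_bound (cpow 2%N) z2 phiM M0).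
suff -> : cauchy_transform phi z - cauchy_transform phi 0 - square_int (fun w => phi w * w ^- 2) * z
   = z ^+ 2 * cauchy_transform (fun w => phi w * w ^- 2) z.
  rewrite expr2 normcM normcM mulrC mulrA ler_wpM2r ?normc_ge0 //.
  have ze' : normc z * (32 * M + 1) <= e by rewrite -ler_pdivlMr ?ltW //; lra.
  apply: le_trans ze'; rewrite mulrC ler_wpM2l ?normc_ge0 //; lra.
rewrite /cauchy_transform.
rewrite (@eq_square_int _ _ (fun w => z ^+ 2 * (phi w * w ^- 2 * (w - z)^-1) +
    (z * (phi w * w ^- 2) + phi w * (w - 0)^-1))).
  have c1 := cont_outside_cauchy (cpow 2%N) z1.
  have c0 : cont_outside (fun w => phi w * (w - 0)^-1).
    by apply: (cont_outside_cauchy cphi); rewrite normc0 ltr01.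
  have c2 : cont_outside (fun w => z * (phi w * w ^- 2) + phi w * (w - 0)^-1).
    move=> w w1; apply: ccontD; last exact: c0.
    by apply: ccontM; [exact: ccont_cst|exact: cpow].
  rewrite (square_int_lin _ c1 c2) (square_int_lin _ (cpow 2%N) c0).
  by ring.
move=> w w1; have w0 : w != 0 by rewrite -normc_gt0; lra.
have wz : w - z != 0.
  by rewrite subr_eq0; apply/negP => /eqP wz; move: w1; rewrite wz leNgt z1.
by rewrite subr0; field; rewrite wz w0.
Qed.

(** By symmetry the four sides contribute equally, and the imaginary part is
    four times the integral of the positive function 1 / (1 + t^2). *)
Lemma winding_neq0 : cauchy_transform (fun=> 1) 0 != 0.
Proof.
pose u (t : R) := (1 + t ^+ 2)^-1.
have d0 (t : R) : 0 < 1 + t ^+ 2 by rewrite ltr_pwDl ?sqr_ge0.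
have cu : continuous u.
  move=> t; apply: (@continuousV R R (fun t => 1 + t ^+ 2)).
    by rewrite gt_eqF.
  by apply: cvgD; [exact: cvg_cst|exact: exprn_continuous].
suff ImE : Im (cauchy_transform (fun=> 1) 0) = 4 * rint u (-1) 1.
  apply/negP => /eqP e0; move: ImE; rewrite e0 /= /rint.
  have m2 : -2 < -1 :> R by lra. have m1 : -1 <= 1 :> R by lra.
  have [c _ ->] := MVT_above m2 m1 (fun x => @prim_derive R u x cu).
  have : 0 < u c by rewrite invr_gt0.
  by lra.
have m2 : -2 < -1 :> R by lra. have p2 : -2 < 1 :> R by lra.
have uN : rint (fun t => - u t) (-1) 1 = - rint u (-1) 1.
  have := @rint_lin R u (fun=> 0) (-1) (-1) 1 cu _ m2 p2.
  rewrite rint_cst // mul0r addr0 mulN1r => <-.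
    by congr rint; apply/funext => t; rewrite mulN1r addr0.
  exact: cst_continuous.
rewrite /cauchy_transform /square_int /rectint /cint /= !mul0r !add0r !mul1r.
have eu v : (forall t, v t = u t) -> rint v (-1) 1 = rint u (-1) 1.
  by move=> vu; congr rint; apply/funext.
have euN v : (forall t, v t = - u t) -> rint v (-1) 1 = - rint u (-1) 1.
  by move=> vu; rewrite -uN; congr rint; apply/funext.
rewrite eu; last by move=> t; rewrite !subr0 sqrrN expr1n [t ^+ 2 + 1]addrC /u; ring.
rewrite [X in _ + X - _ - _]eu; last first.
  by move=> t; rewrite !subr0 expr1n /u; ring.
rewrite [X in _ + _ - X - _]euN; last first.
  by move=> t; rewrite !subr0 expr1n [t ^+ 2 + 1]addrC /u; ring.
rewrite [X in _ + _ - _ - X]euN; last first.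
  by move=> t; rewrite !subr0 sqrrN expr1n /u; ring.
ring.
Qed.

Lemma winding_near0 : exists2 r : R, 0 < r <= 1 / 2 &
  forall z, normc z < r -> cauchy_transform (fun=> 1) z != 0.
Proof.
have c1 : cont_outside (fun=> 1 : C) by move=> w _; exact: ccont_cst.
have N0 : 0 < normc (cauchy_transform (fun=> 1 : C) 0) by rewrite normc_gt0 winding_neq0.
have [r r0 H] := (ccontP _ _).1 (derivable_ccont (cauchy_transform_derivable c1)) _ N0.
exists (Num.min r (1 / 2)) => [|z].
  by rewrite lt_min r0 ge_min lexx orbT andbT; lra.
rewrite lt_min => /andP[zr _]; apply/negP => /eqP e.
by have := H z; rewrite subr0 e sub0r normcN ltxx => /(_ zr).
Qed.

End CauchyFormula.

(** * Division, identity and reflection for entire functions *)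

Section EntireFunctions.
Context {R : realType}.
Local Open Scope complex_scope.
Local Notation C := R[i].
Implicit Types (f g phi : C -> C) (z w d k p : C).

Lemma normcX z n : normc (z ^+ n) = normc z ^+ n.
Proof. by elim: n => [|n IH]; rewrite ?normc1 // !exprS normcM IH. Qed.

Lemma entire_shift f a : entire f -> entire (fun z => f (z + a)).
Proof.
move=> ef z; apply/(@cdiffP R (fun z => f (z + a))).
have [d H] := (cdiffP _ _).1 (ef (z + a)); exists d => e e0.
have [r r0 h] := H e e0; exists r => // w wz.
have -> : w - z = w + a - (z + a) by ring.
by apply: h; have -> : w + a - (z + a) = w - z by ring.
Qed.

Lemma entire_scale f a : a != 0 -> entire f -> entire (fun z => f (a * z)).
Proof.
move=> a0 ef z; apply/(@cdiffP R (fun z => f (a * z))).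
have na : 0 < normc a by rewrite normc_gt0.
have [d H] := (cdiffP _ _).1 (ef (a * z)); exists (d * a) => e e0.
have [|r r0 h] := H (e / normc a); first by rewrite divr_gt0.
exists (r / normc a); first by rewrite divr_gt0.
move=> w; rewrite ltr_pdivlMr // mulrC -normcM mulrBr => /h.
rewrite -mulrBr mulrA normcM mulrA divfK //.
by rewrite gt_eqF.
Qed.

Lemma entire_cst d : entire (fun=> d : C).
Proof. by move=> z; exact: cderivable_cst. Qed.

Lemma entire_id : entire (id : C -> C).
Proof. by move=> z; exact: cderivable_id. Qed.

Lemma entireD f g : entire f -> entire g -> entire (fun z => f z + g z).
Proof. by move=> ef eg z; exact: (cderivableD (ef z) (eg z)). Qed.

Lemma entireB f g : entire f -> entire g -> entire (fun z => f z - g z).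
Proof. by move=> ef eg z; exact: (cderivableB (ef z) (eg z)). Qed.

Lemma entireM f g : entire f -> entire g -> entire (fun z => f z * g z).
Proof. by move=> ef eg z; exact: (cderivableM (ef z) (eg z)). Qed.

Lemma eq_entire f g : f =1 g -> entire f -> entire g.
Proof. by move=> /funext ->. Qed.

(** If f 0 = 0, then Cauchy's formula for f, minus the same formula at 0, gives
    z times the Cauchy transform of f w / w. So, near 0, the quotient f z / z is
    a ratio of two functions differentiable at 0. *)
Lemma entire_div0 f : entire f -> f 0 = 0 ->
  exists2 g, entire g & forall z, f z = z * g z.
Proof.
move=> ef f0.
pose phi w := f w * w^-1.
have cphi : cont_outside phi.
  move=> w w1; apply: ccontM; first exact: (entire_ccont ef).
  by apply: ccontV; [rewrite -normc_gt0; lra|exact: ccont_id].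
have c1 : cont_outside (fun=> 1 : C) by move=> w _; exact: ccont_cst.
have key z : normc z < 1 -> f z * cauchy_transform (fun=> 1) z = z * cauchy_transform phi z.
  move=> z1; rewrite (cauchy_formula ef z1).
  have phi0 : cauchy_transform f 0 = 0 by rewrite -(cauchy_formula ef) ?f0 ?mul0r ?normc0.
  rewrite /cauchy_transform (@eq_square_int _ _ (fun w =>
    z * (phi w * (w - z)^-1) + f w * (w - 0)^-1)).
    have cz : cont_outside (fun w => phi w * (w - z)^-1) := cont_outside_cauchy cphi z1.
    have cf0 : cont_outside (fun w => f w * (w - 0)^-1).
      apply: (@cont_outside_cauchy _ f 0); last by rewrite normc0 ltr01.
      by move=> w _; exact: (entire_ccont ef).
    by rewrite (square_int_lin _ cz cf0) -/(cauchy_transform f 0) phi0 addr0.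
  move=> w w1; have w0 : w != 0 by rewrite -normc_gt0; lra.
  have wz : w - z != 0.
    by rewrite subr_eq0; apply/negP => /eqP wz; move: w1; rewrite wz leNgt z1.
  by rewrite subr0 /phi; field; rewrite wz w0.
have [r /andP[r0 r2] Wr] := @winding_near0 R.
(* At 0 the value is dictated by the identity key. *)
pose W := cauchy_transform (fun=> 1 : C).
pose g z := if z == 0 then cauchy_transform phi 0 * (W 0)^-1 else f z * z^-1.
exists g; last first.
  move=> z; rewrite /g; case: eqP => [->|/eqP z0]; first by rewrite f0 mul0r.
  by rewrite mulrC divfK.
move=> z; have [->|z0] := eqVneq z 0.
  apply: (@near_derivable _ (fun z => cauchy_transform phi z * (W z)^-1) _ _ r) => //.
    move=> w; rewrite subr0 => wr; rewrite /g; case: eqP => [->//|/eqP w0].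
    apply: (mulIf (Wr w wr)); rewrite divfK ?Wr //.
    by rewrite mulrAC key; [rewrite mulrC mulKf|lra].
  apply: cderivableM; first exact: cauchy_transform_derivable.
  by apply: cderivableV; [apply: Wr; rewrite normc0|exact: cauchy_transform_derivable].
apply: (@near_derivable _ (fun z => f z * z^-1) _ _ (normc z)).
- by rewrite normc_gt0.
- move=> w wz; rewrite /g; case: eqP => // w0.
  by move: wz; rewrite w0 sub0r normcN ltxx.
apply: cderivableM; first exact: ef.
by apply: cderivableV => //; exact: cderivable_id.
Qed.

Lemma entire_div f a : entire f -> f a = 0 ->
  exists2 g, entire g & forall z, f z = (z - a) * g z.
Proof.
move=> ef fa; have [|g eg fg] := entire_div0 (entire_shift (a := a) ef).
  by rewrite add0r.
exists (fun z => g (z - a)); first exact: entire_shift.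
by move=> z; rewrite -fg subrK.
Qed.

Lemma entire_div_prod f (s : seq C) : entire f -> uniq s ->
  {in s, forall a, f a = 0} ->
  exists2 g, entire g & forall z, f z = (\prod_(a <- s) (z - a)) * g z.
Proof.
elim: s f => [|a s IH] f ef.
  by move=> _ _; exists f => // z; rewrite big_nil mul1r.
move=> /= /andP[as_ us] fs.
have [|g eg fg] := @entire_div f a ef; first by apply: fs; rewrite mem_head.
have [|h eh gh] := IH g eg us; last first.
  by exists h => // z; rewrite fg gh big_cons mulrA.
move=> b bs; have := fs b; rewrite inE bs orbT fg => /(_ isT)/eqP.
rewrite mulf_eq0 subr_eq0 => /orP[/eqP ba|/eqP//].
by move: as_; rewrite -ba bs.
Qed.

Lemma sep_seq (s : seq C) z : exists2 r : R, 0 < r &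
  forall w, w \in s -> normc (w - z) < r -> w = z.
Proof.
elim: s => [|a s [r r0 H]]; first by exists 1.
have [->|az] := eqVneq a z.
  by exists r => // w; rewrite inE => /orP[/eqP->|]//; exact: H.
exists (Num.min r (normc (a - z))).
  by rewrite lt_min r0 normc_gt0 subr_eq0.
move=> w; rewrite inE lt_min => /orP[/eqP->|ws] /andP[]; last by move=> + _; exact: H.
by rewrite ltxx.
Qed.

(** Removing finitely many points does not change the limits of a continuous
    function, so on a finite set by_continuity computes any continuous
    extension. *)
Lemma by_continuity_eq (S : set C) (s : seq C) f g :
  (forall w, S w -> w \in s) -> (forall w, ~ S w -> f w = g w) ->
  (forall w, ccont g w) -> by_continuity S f = g.
Proof.
move=> Ss fg cg; apply/funext => w; rewrite /by_continuity.
case: ifPn => [_|]; last by move=> /negP wS; apply: fg => Sw; apply: wS; rewrite inE.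
have [r r0 H] := sep_seq s w.
apply: (@cvg_lim C^o) => //.
have cgw : (g : C^o -> C^o) @ (w : C^o)^' --> (g w : C^o).
  by apply: cvg_trans (cg w); apply: cvg_app; exact: cvg_within.
apply: cvg_trans cgw; apply: near_eq_cvg.
rewrite near_withinE; apply/nbhs_ballP; exists r%:C => /=; first by rewrite ltcR.
move=> x; rewrite /ball /= normE ltcR normcB => xr xw.
symmetry; apply: fg => /Ss xs; move: xw; rewrite (H _ xs xr) => /eqP; exact.
Qed.

Lemma zero_on_reals_at0 f : entire f -> (forall x : R, x != 0 -> f x%:C = 0) -> f 0 = 0.
Proof.
move=> ef fR; apply: contrapT => /eqP; rewrite -normc_gt0 => N0.
have [r r0 H] := (ccontP _ _).1 (@entire_ccont _ _ 0 ef) _ N0.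
have := H (r / 2)%:C; rewrite subr0 normc_real fR; last first.
  by rewrite gt_eqF // divr_gt0.
rewrite sub0r normcN ltxx ger0_norm; last by rewrite divr_ge0 // ltW.
by move=> H2; have : false by apply: H2; lra.
Qed.

(** Such an f is z^n times an entire function, for every n. The quotients are
    bounded by |f| on the boundary of the unit square, so Cauchy's formula
    bounds |f z| by a constant times |z|^n. The radius does not depend on f. *)
Lemma entire_zero_near0 : exists2 r : R, 0 < r &
  forall f, entire f -> (forall x : R, f x%:C = 0) ->
  forall z, normc z < r -> f z = 0.
Proof.
have [r /andP[r0 r2] Wr] := @winding_near0 R.
exists r => // f ef fR z zr.
have roots n : exists2 g, entire g /\ (forall x : R, g x%:C = 0) &
    forall w, f w = w ^+ n * g w.
  elim: n => [|n [g [eg gR] fg]]; first by exists f => // w; rewrite mul1r.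
  have [|h eh gh] := entire_div0 eg; first exact: (gR 0).
  have hR (x : R) : x != 0 -> h x%:C = 0.
    move=> x0; have := gR x; rewrite gh => /eqP; rewrite mulf_eq0.
    by rewrite -[0]/(0%:C) (inj_eq (@complexI _)) (negPf x0) => /eqP.
  exists h; last by move=> w; rewrite fg gh mulrA exprSr.
  split=> // x; have [->|] := eqVneq x 0; last exact: hR.
  exact: zero_on_reals_at0.
have [M M0 fM] := on_square_bounded (fun w _ => entire_ccont ef).
have W0 := Wr z zr.
apply: contrapT => /eqP fz0.
have N0 : 0 < normc (f z * cauchy_transform (fun=> 1) z) by rewrite normc_gt0 mulf_neq0.
have [n] := small_pow2 (32 * M) N0; apply/negP; rewrite -leNgt.
have [g [eg _] fg] := roots n.
rewrite fg -mulrA (cauchy_formula eg); last by lra.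
have gM w : on_square w -> normc (g w) <= M.
  move=> sw; apply: le_trans (fM w sw); rewrite fg normcM.
  rewrite ler_peMl ?normc_ge0 //.
  by rewrite normcX exprn_ege1 ?on_square_outside.
have b : normc (cauchy_transform g z) <= 32 * M.
  apply: (cauchy_transform_bound _ _ gM M0); last by lra.
  by move=> w _; exact: (entire_ccont eg).
rewrite normcM mulrC ler_pM ?normc_ge0 // normcX -exprVn.
by apply: lerXn2r; rewrite ?nnegrE ?normc_ge0 ?invr_ge0 //; lra.
Qed.

(** A dilation by a positive number preserves the hypotheses and brings z into
    the disc where entire_zero_near0 applies. *)
Lemma entire_zero_on_reals f : entire f -> (forall x : R, f x%:C = 0) -> forall z, f z = 0.
Proof.
move=> ef fR z; have [r r0 H] := entire_zero_near0.
pose t : R := (normc z + 1) / r.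
have t0 : 0 < t by rewrite divr_gt0 // ltr_wpDl ?normc_ge0.
have tC : t%:C != 0 :> C by rewrite -[0]/(0%:C) (inj_eq (@complexI _)) gt_eqF.
have -> : z = t%:C * (z / t%:C) by rewrite mulrC divfK.
apply: (H (fun w => f (t%:C * w))).
- exact: entire_scale.
- by move=> x; rewrite -rmorphM; exact: fR.
rewrite normcM normcV normc_real gtr0_norm // ltr_pdivrMr // /t mulrC divfK ?gt_eqF //.
by rewrite ltrDl.
Qed.

Lemma normc_conj z : normc (conjc z) = normc z.
Proof. by apply: complexI; rewrite -!normE complex.normcJ. Qed.

Lemma entire_star f : entire f -> entire (star f).
Proof.
move=> ef z; apply/cdiffP; rewrite /star.
have [d H] := (cdiffP _ _).1 (ef (conjc z)); exists (conjc d) => e e0.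
have [r r0 h] := H e e0; exists r => // w wz.
have := h (conjc w); rewrite -rmorphB normc_conj => /(_ wz).
move=> h2; rewrite -[X in X <= _]normc_conj.
move: h2; congr (normc _ <= _).
by rewrite !rmorphB rmorphM /= !conjcK rmorphB.
Qed.

(** The functions f and its conjugate by the reflection are entire and agree on
    the reals. *)
Lemma reflection f : entire f -> real_on_reals f -> forall z, f (z^*)%R = ((f z)^*)%R.
Proof.
move=> ef fR z.
have sf w : star f w = f w.
  apply/eqP; rewrite -subr_eq0; apply/eqP.
  apply: (entire_zero_on_reals (entireB (entire_star ef) ef)) => x.
  by rewrite /star (conj_Creal (_ : x%:C \is Num.real)) ?complex_real // conj_Creal ?subrr.
by rewrite -[in RHS]sf /star conjCK.
Qed.

End EntireFunctions.

(** * Hilbert spaces of entire functions *)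

Section Hilbert.
Context {R : realType} (H : fun_space R) (hH : hilbert_of_entire H).
Local Notation C := R[i].
Implicit Types (f g h k : C -> C) (z w a b : C).

Lemma carrierZ a f : carrier H f -> carrier H (fun w => a * f w).
Proof.
move=> cf; have -> : (fun w => a * f w) = (fun w => a * f w + 0).
  by apply/funext => w; rewrite addr0.
exact: (hoe_lin hH a cf (hoe_zero hH)).
Qed.

Lemma carrierB f g : carrier H f -> carrier H g -> carrier H (fun w => f w - g w).
Proof.
move=> cf cg; have -> : (fun w => f w - g w) = (fun w => (-1) * g w + f w).
  by apply/funext => w; rewrite mulN1r addrC.
exact: (hoe_lin hH (-1) cg cf).
Qed.

Lemma carrier_sum (T : Type) (r : seq T) (c : T -> C) (v : T -> C -> C) :
  (forall t, carrier H (v t)) -> carrier H (fun w => \sum_(t <- r) c t * v t w).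
Proof.
move=> cv; elim: r => [|t r IH].
  have -> : (fun w => \sum_(t <- [::]) c t * v t w) = (fun=> 0).
    by apply/funext => w; rewrite big_nil.
  exact: hoe_zero.
have -> : (fun w => \sum_(i <- t :: r) c i * v i w) =
    (fun w => c t * v t w + \sum_(i <- r) c i * v i w).
  by apply/funext => w; rewrite big_cons.
exact: (hoe_lin hH (c t) (cv t) IH).
Qed.

Lemma ip0r f : carrier H f -> ip H f (fun=> 0) = 0.
Proof.
move=> cf; have := hoe_ip_linear_r hH 1 (hoe_zero hH) (hoe_zero hH) cf.
rewrite (_ : (fun w => _) = (fun=> 0)); last by apply/funext => w; rewrite mulr0 addr0.
by rewrite mul1r => /eqP; rewrite -subr_eq0 opprD addrA subrr sub0r oppr_eq0 => /eqP.
Qed.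

Lemma ipZr a f h : carrier H f -> carrier H h ->
  ip H h (fun w => a * f w) = a * ip H h f.
Proof.
move=> cf ch; have := hoe_ip_linear_r hH a cf (hoe_zero hH) ch.
rewrite ip0r // addr0 => <-; congr (ip H h _).
by apply/funext => w; rewrite addr0.
Qed.

Lemma ipBr f g h : carrier H f -> carrier H g -> carrier H h ->
  ip H h (fun w => f w - g w) = ip H h f - ip H h g.
Proof.
move=> cf cg ch; have := hoe_ip_linear_r hH (-1) cg cf ch.
rewrite mulN1r addrC => <-; congr (ip H h _).
by apply/funext => w; rewrite mulN1r addrC.
Qed.

Lemma ipBl f g h : carrier H f -> carrier H g -> carrier H h ->
  ip H (fun w => f w - g w) h = ip H f h - ip H g h.
Proof.
move=> cf cg ch; rewrite (hoe_ip_conj hH ch (carrierB cf cg)) ipBr //.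
by rewrite rmorphB /= -!(hoe_ip_conj hH).
Qed.

Lemma ipZl a f h : carrier H f -> carrier H h ->
  ip H (fun w => a * f w) h = a^* * ip H f h.
Proof.
move=> cf ch; rewrite (hoe_ip_conj hH ch (carrierZ a cf)) ipZr //.
by rewrite rmorphM /= -(hoe_ip_conj hH).
Qed.

Lemma ip_suml (T : Type) (r : seq T) (c : T -> C) (v : T -> C -> C) h :
  (forall t, carrier H (v t)) -> carrier H h ->
  ip H (fun w => \sum_(t <- r) c t * v t w) h = \sum_(t <- r) (c t)^* * ip H (v t) h.
Proof.
move=> cv ch; elim: r => [|t r IH].
  rewrite big_nil (_ : (fun w => _) = (fun=> 0)); last first.
    by apply/funext => w; rewrite big_nil.
  by rewrite (hoe_ip_conj hH ch (hoe_zero hH)) ip0r // rmorph0.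
rewrite big_cons -IH (_ : (fun w => _) =
    (fun w => c t * v t w + \sum_(i <- r) c i * v i w)); last first.
  by apply/funext => w; rewrite big_cons.
have cs := carrier_sum r c cv.
rewrite (hoe_ip_conj hH ch (hoe_lin hH (c t) (cv t) cs)).
rewrite (hoe_ip_linear_r hH (c t) (cv t) cs ch) rmorphD rmorphM /=.
by rewrite -!(hoe_ip_conj hH).
Qed.

Lemma ipnorm_ge0 f : carrier H f -> 0 <= ipnorm H f.
Proof. by move=> cf; rewrite sqrtC_ge0 (hoe_ip_ge0 hH). Qed.

Lemma ipnormK f : ipnorm H f ^+ 2 = ip H f f.
Proof. by rewrite sqrtCK. Qed.

Lemma cauchy_schwarz f k : carrier H k -> carrier H f ->
  `|ip H k f| <= ipnorm H k * ipnorm H f.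
Proof.
move=> ck cf.
rewrite -(ler_pXn2r (n := 2)) //; last first.
  by rewrite nnegrE mulr_ge0 ?ipnorm_ge0.
rewrite exprMn !ipnormK.
have kk := hoe_ip_ge0 hH ck.
have [k0|kN0] := eqVneq (ip H k k) 0.
  rewrite (hoe_ip_eq0 hH ck k0) (hoe_ip_conj hH cf (hoe_zero hH)) ip0r //.
  rewrite rmorph0 normr0 expr0n /= mulr_ge0 ?(hoe_ip_ge0 hH) //.
  exact: hoe_zero.
have kgt0 : 0 < ip H k k by rewrite lt_def kN0.
set c := ip H k f / ip H k k.
have ckf := carrierB cf (carrierZ c ck).
have := hoe_ip_ge0 hH ckf.
have cc := carrierZ c ck.
have cE : c^* = (ip H k f)^* / ip H k k.
  by rewrite rmorphM /= fmorphV /= -(hoe_ip_conj hH ck ck).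
rewrite (ipBr cf cc ckf) (ipBl cf cc cf) (ipBl cf cc cc) !(ipZl _ ck) // !(ipZr _ ck) //.
rewrite (hoe_ip_conj hH ck cf) cE.
have -> : forall F, F - (ip H k f)^* / ip H k k * ip H k f
   - (c * (ip H k f)^* - (ip H k f)^* / ip H k k * (c * ip H k k))
   = F - ip H k f * (ip H k f)^* / ip H k k.
  by move=> F; rewrite /c; field.
by rewrite -normCK subr_ge0 ler_pdivrMr // mulrC.
Qed.

Lemma evaluator_unique z k k' :
  is_evaluator H z k -> is_evaluator H z k' -> k = k'.
Proof.
move=> [ck kE] [ck' k'E]; have cd := carrierB ck ck'.
have := hoe_ip_eq0 hH cd; rewrite ipBl // -kE // -k'E // subrr => /(_ erefl) e.
by apply/funext => w; have /eqP := congr1 (@^~ w) e; rewrite subr_eq0 => /eqP.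
Qed.

End Hilbert.

(** * Interpolation and parity of polynomials *)

Section Interpolation.
Context {F : fieldType}.
Implicit Types (p : seq F) (a b w : F) (q r : {poly F}).

(** The Lagrange polynomial at a, not normalised to take the value 1 at a. *)
Definition lagr p a : {poly F} := \prod_(b <- p | b != a) ('X - b%:P).

Lemma lagr_other p a b : a \in p -> a != b -> (lagr p b).[a] = 0.
Proof.
move=> ap ab; rewrite /lagr horner_prod; apply/eqP; rewrite prodf_seq_eq0.
by apply/hasP; exists a => //; rewrite ab hornerXsubC subrr eqxx.
Qed.

Lemma lagr_self p a : (lagr p a).[a] != 0.
Proof.
rewrite /lagr horner_prod prodf_seq_neq0; apply/allP => b _; apply/implyP => ba.
by rewrite hornerXsubC subr_eq0 eq_sym.
Qed.

Lemma lagr_prod p a w : uniq p -> a \in p ->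
  (w - a) * (lagr p a).[w] = \prod_(b <- p) (w - b).
Proof.
move=> up ap; rewrite (bigD1_seq a) //= /lagr horner_prod; congr (_ * _).
by apply: eq_bigr => b _; rewrite hornerXsubC.
Qed.

Lemma size_lagr p a : uniq p -> a \in p -> (size (lagr p a) <= size p)%N.
Proof.
move=> up ap; rewrite /lagr -big_filter size_prod_XsubC.
rewrite -(rem_filter a up) size_rem // prednK //.
by case: p ap {up}.
Qed.

Lemma poly_eq0_roots q p : uniq p -> (size q <= size p)%N ->
  (forall a, a \in p -> q.[a] = 0) -> q = 0.
Proof.
move=> up qp q0; apply: (roots_geq_poly_eq0 (rs := p)) => //.
by apply/allP => a ap; apply/rootP; exact: q0.
Qed.

Lemma interpolation p (c : F -> F) q : uniq p -> (size q <= size p)%N ->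
  (forall a, a \in p -> q.[a] = c a) ->
  q = \sum_(a <- p) (c a / (lagr p a).[a]) *: lagr p a.
Proof.
move=> up qp qc; apply/eqP; rewrite -subr_eq0; apply/eqP.
apply: (poly_eq0_roots up).
  apply: leq_trans (size_polyD _ _) _; rewrite geq_max qp size_polyN /=.
  rewrite big_seq; elim/big_ind: _ => [|x y hx hy|a ap].
  - by rewrite size_poly0.
  - by apply: leq_trans (size_polyD _ _) _; rewrite geq_max hx.
  - by apply: leq_trans (size_scale_leq _ _) _; exact: size_lagr.
move=> a ap; rewrite hornerD hornerN horner_sum (bigD1_seq a) //=.
rewrite hornerZ divfK ?lagr_self // qc // big1_seq ?addr0 ?subrr //.
move=> b /andP[ba _]; have ab : a != b by rewrite eq_sym.
by rewrite hornerZ (lagr_other ap ab) mulr0.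
Qed.

(** In column j of the matrices the parity of the row decides between two
    functions; collecting the coefficients by parity gives an even and an odd
    polynomial. *)
Definition even_part (m : nat) (c : nat -> F) : {poly F} :=
  \poly_(k < m) (if odd k then 0 else c k).
Definition odd_part (m : nat) (c : nat -> F) : {poly F} :=
  \poly_(k < m) (if odd k then c k else 0).

Lemma even_odd_part m c (x y w : F) :
  (even_part m c).[w] * x + (odd_part m c).[w] * y
  = \sum_(k < m) c k * (w ^+ k * (if odd k then y else x)).
Proof.
rewrite /even_part /odd_part !horner_poly !mulr_suml -big_split /=.
by apply: eq_bigr => k _; case: (odd k); ring.
Qed.

Lemma even_partN m c w : (even_part m c).[- w] = (even_part m c).[w].
Proof.
rewrite /even_part !horner_poly; apply: eq_bigr => k _.
by rewrite exprNn -signr_odd; case: (odd k); rewrite ?mul0r // expr0 mul1r.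
Qed.

Lemma odd_partN m c w : (odd_part m c).[- w] = - (odd_part m c).[w].
Proof.
rewrite /odd_part !horner_poly -sumrN; apply: eq_bigr => k _.
by rewrite exprNn -signr_odd; case: (odd k); rewrite ?mul0r ?oppr0 // expr1 mulN1r mulrN.
Qed.

Lemma coef_top_mul q r m : (size q <= m.+1)%N -> (size r <= m.+1)%N ->
  (q * r)`_(m + m) = q`_m * r`_m.
Proof.
move=> qm rm; rewrite coefM.
have mm : (m < (m + m).+1)%N by rewrite ltnS leq_addr.
rewrite (bigD1 (Ordinal mm)) //= addnK big1 ?addr0 // => -[i hi] /=.
rewrite -val_eqE /= => im; have [lt|le] := ltnP m i.
  by rewrite nth_default ?mul0r //; exact: leq_trans qm lt.
have lt : (i < m)%N by rewrite ltn_neqAle im.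
rewrite [X in _ * X]nth_default ?mulr0 //; apply: leq_trans rm _.
by rewrite -addnBA ?addnS // -[X in (X < _)%N]addn0 ltn_add2l subn_gt0.
Qed.

Lemma coef_high_mul q r m j : (size q <= m.+1)%N -> (size r <= m.+1)%N ->
  (m + m < j)%N -> (q * r)`_j = 0.
Proof.
move=> qm rm mj; apply: nth_default; apply: leq_trans (size_polyMleq _ _) _.
apply: leq_trans mj; have := leq_add qm rm; rewrite addSn addnS.
by case: (size q + size r)%N => // x; rewrite /= !ltnS => /leqW.
Qed.

End Interpolation.

Section FinitePoints.
Context {R : realType}.
Local Notation C := R[i].
Implicit Types (f g : C -> C) (z w : C).

Lemma eq_off_seq (p : seq C) f g : (forall w, ccont f w) -> (forall w, ccont g w) ->
  (forall w, w \notin p -> f w = g w) -> f = g.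
Proof.
move=> cf cg fg; pose S := [set` p].
rewrite -(@by_continuity_eq R S p f f) // (@by_continuity_eq R S p f g) // => w Sw.
by apply: fg; apply/negP.
Qed.

End FinitePoints.

(** * The bordered determinants *)

Section BorderedDeterminant.
Context {R : realType}.
Local Notation C := R[i].
Implicit Types (w z a : C).
(* The pair X, Y will be A, B with delta = 1, then B, A with delta = - 1. *)
Variables (X Y : C -> C) (n : nat) (s : 'I_n -> C) (eps delta : C).
Hypotheses (eX : entire X) (eY : entire Y).
Hypotheses (XJ : forall z, X z^* = (X z)^*) (YJ : forall z, Y z^* = (Y z)^*).
Hypotheses (XN : forall z, X (- z) = delta * X z).
Hypotheses (YN : forall z, Y (- z) = - (delta * Y z)).
Hypotheses (hs : injective s) (sJ : forall i, (s i)^* = - s i).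
Hypothesis ss : forall i j, s i + s j != 0.
Hypothesis epsJ : eps^* = eps.

(** The zeros of gamma^-1 and of its reflection, in the order in which pmprodE
    splits the product. *)
Definition pmpts : seq C := [seq s i | i : 'I_n] ++ [seq - s i | i : 'I_n].

Lemma mem_ppt i : s i \in pmpts.
Proof. by rewrite mem_cat; apply/orP; left; apply: map_f; rewrite mem_enum. Qed.

Lemma mem_mpt i : - s i \in pmpts.
Proof.
by rewrite mem_cat; apply/orP; right; apply/mapP; exists i; rewrite ?mem_enum.
Qed.

Lemma pmptsP w : w \in pmpts -> exists i, w = s i \/ w = - s i.
Proof.
by rewrite mem_cat => /orP[] /mapP[i _ ->]; exists i; [left|right].
Qed.

Lemma pmptsJ w : (w^* \in pmpts) = (w \in pmpts).
Proof.
have J x : x \in pmpts -> x^* \in pmpts.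
  by move=> /pmptsP[i [->|->]]; rewrite ?rmorphN /= sJ ?opprK ?mem_ppt ?mem_mpt.
by apply/idP/idP => /J //; rewrite conjCK.
Qed.

Lemma uniq_mpts : uniq [seq - s i | i : 'I_n].
Proof. by rewrite map_inj_uniq ?enum_uniq // => i j /oppr_inj/hs. Qed.

Lemma uniq_pmpts : uniq pmpts.
Proof.
rewrite cat_uniq map_inj_uniq ?enum_uniq // uniq_mpts andbT /=.
apply/hasPn => _ /mapP[i _ ->]; apply/negP => /mapP[j _ /eqP].
by rewrite eq_sym -addr_eq0; apply/negP; exact: ss.
Qed.

Lemma size_pmpts : size pmpts = (n + n)%N.
Proof. by rewrite size_cat !size_map -enumT size_enum_ord. Qed.

(* Proved below, for both pairs, from the independence of the evaluators. *)
Hypothesis XYfree : forall q r : {poly C}, (size q <= n)%N -> (size r <= n)%N ->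
  (forall a, a \in pmpts -> q.[a] * X a + r.[a] * Y a = 0) -> q = 0 /\ r = 0.

Definition pmprod w := \prod_(a <- pmpts) (w - a).

Lemma pmprod_neq0 w : (pmprod w != 0) = (w \notin pmpts).
Proof.
rewrite /pmprod prodf_seq_neq0; apply/allP/idP => [h|h a ap].
  by apply/negP => wp; have := h w wp; rewrite subrr eqxx.
by apply/implyP => _; rewrite subr_eq0; apply/negP => /eqP wa; rewrite wa ap in h.
Qed.

Lemma pmprodE w : pmprod w = (\prod_i (w - s i)) * (\prod_i (w + s i)).
Proof.
rewrite /pmprod big_cat /= !big_map -!enumT !big_enum /=; congr (_ * _).
by apply: eq_bigr => i _; rewrite opprK.
Qed.

Lemma pmprodN w : pmprod (- w) = pmprod w.
Proof.
by rewrite !pmprodE -!big_split /=; apply: eq_bigr => i _; ring.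
Qed.

Lemma pmprodJ w : pmprod w^* = (pmprod w)^*.
Proof.
rewrite !pmprodE mulrC rmorphM !rmorph_prod /=; congr (_ * _);
by apply: eq_bigr => i _; rewrite ?rmorphB ?rmorphD /= sJ ?opprK.
Qed.

Lemma gamma_star w : gamma s w * star (gamma s) w = (pmprod w)^-1.
Proof.
rewrite pmprodE invfM -!prodfV /star /gamma rmorph_prod; congr (_ * _).
by apply: eq_bigr => i _; rewrite fmorphV /= rmorphB /= conjCK sJ opprK.
Qed.

Let U := alt_matrix X Y s.

Lemma parity_comb (q r : {poly C}) w :
  (forall z, q.[- z] = q.[z]) -> (forall z, r.[- z] = - r.[z]) ->
  q.[- w] * X (- w) + r.[- w] * Y (- w) = delta * (q.[w] * X w + r.[w] * Y w).
Proof. by move=> qe ro; rewrite qe ro XN YN; ring. Qed.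

(** A linear relation between the rows is a pair of polynomials of size at most
    n whose combination vanishes at the s_i, hence by parity at all of pmpts. *)
Lemma detU_neq0 : \det U != 0.
Proof.
apply/negP => /det0P[v v0 vU].
pose c k := if insub k is Some i then v 0 i else 0.
have cE (k : 'I_n) : c k = v 0 k by rewrite /c valK.
have vanish i : (even_part n c).[s i] * X (s i) + (odd_part n c).[s i] * Y (s i) = 0.
  have e : \sum_k v 0 k * U k i = 0.
    by have := congr1 (fun M : 'rV_n => M 0 i) vU; rewrite !mxE.
  by rewrite even_odd_part -[RHS]e; apply: eq_bigr => k _; rewrite cE mxE.
have [] := @XYfree (even_part n c) (odd_part n c).
- exact: size_poly.
- exact: size_poly.
- move=> a /pmptsP[i [->|->]]; first exact: vanish.
  by rewrite parity_comb ?vanish ?mulr0 // => z; [exact: even_partN|exact: odd_partN].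
move=> e0 o0; case/negP: v0; apply/eqP/rowP => k; rewrite mxE -cE.
have := congr1 (fun q : {poly C} => q`_k) e0; have := congr1 (fun q : {poly C} => q`_k) o0.
by rewrite !coef_poly ltn_ord coef0; case: (odd k).
Qed.

Lemma append_pt_lift w i : append_pt s w (lift ord_max i) = s i.
Proof. by rewrite /append_pt liftK. Qed.

Lemma append_pt_max w : append_pt s w ord_max = w.
Proof. by rewrite /append_pt unlift_none. Qed.

Let bord w := alt_matrix X Y (append_pt s w).
Let c k := eps / \det U * cofactor (bord 0) (inord k) ord_max.
Let polX := even_part n.+1 c.
Let polY := odd_part n.+1 c.

(** Cofactors of the last column do not involve its entries, so the determinant
    is a combination of the functions w^k X(w) and w^k Y(w) with constant
    coefficients. *)
Lemma cofactor_bord w k : cofactor (bord w) k ord_max = cofactor (bord 0) k ord_max.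
Proof.
rewrite /cofactor; congr (_ * \det _); apply/matrixP => i j.
by rewrite !mxE !append_pt_lift.
Qed.

Lemma bord_comb w : polX.[w] * X w + polY.[w] * Y w = eps / \det U * \det (bord w).
Proof.
rewrite even_odd_part (expand_det_col _ ord_max) mulr_sumr; apply: eq_bigr => k _.
rewrite cofactor_bord !mxE append_pt_max /c inord_val.
by rewrite -[LHS]mulrA [cofactor _ _ _ * _]mulrC.
Qed.

(** The last cofactor is the minor \det U, which the normalisation divides out.
    The parity of n decides which polynomial has it as leading coefficient. *)
Lemma c_top : c n = eps.
Proof.
rewrite /c; have -> : inord n = ord_max :> 'I_n.+1 by apply/val_inj; rewrite /= inordK.
have -> : cofactor (bord 0) ord_max ord_max = \det U.
  rewrite /cofactor -signr_odd oddD addbb expr0 mul1r; congr (\det _).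
  by apply/matrixP => i j; rewrite !mxE !append_pt_lift lift_max.
by rewrite divfK // detU_neq0.
Qed.

Lemma polX_top : polX`_n = if odd n then 0 else eps.
Proof. by rewrite coef_poly ltnSn c_top. Qed.

Lemma polY_top : polY`_n = if odd n then eps else 0.
Proof. by rewrite coef_poly ltnSn c_top. Qed.

Lemma size_polX : (size polX <= n.+1)%N. Proof. exact: size_poly. Qed.
Lemma size_polY : (size polY <= n.+1)%N. Proof. exact: size_poly. Qed.
Lemma polX_even w : polX.[- w] = polX.[w]. Proof. exact: even_partN. Qed.
Lemma polY_odd w : polY.[- w] = - polY.[w]. Proof. exact: odd_partN. Qed.

(** At s_i two columns of the determinant are equal. *)
Lemma comb_vanish a : a \in pmpts -> polX.[a] * X a + polY.[a] * Y a = 0.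
Proof.
have zero i : polX.[s i] * X (s i) + polY.[s i] * Y (s i) = 0.
  rewrite bord_comb -(det_tr (bord _)).
  rewrite (determinant_alternate (i1 := lift ord_max i) (i2 := ord_max)).
  - by rewrite mulr0.
  - by rewrite eq_sym neq_lift.
  - by move=> k; rewrite /bord !mxE append_pt_lift append_pt_max.
move=> /pmptsP[i [->|->]]; first exact: zero.
by rewrite parity_comb ?zero ?mulr0 // => z; [exact: polX_even|exact: polY_odd].
Qed.

Lemma size_shrink (p : {poly C}) : (size p <= n.+1)%N -> p`_n = 0 -> (size p <= n)%N.
Proof.
move=> sp pn; apply/leq_sizeP => j; rewrite leq_eqVlt => /orP[/eqP<-//|nj].
by apply: nth_default; exact: leq_trans nj.
Qed.

(** Conjugating the coefficients gives another pair with the same vanishing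
    property and the same top coefficients; the difference has smaller size, so
    it is zero. *)
Lemma pol_real : map_poly Num.conj polX = polX /\ map_poly Num.conj polY = polY.
Proof.
have horJ (p : {poly C}) z : (map_poly Num.conj p).[z] = (p.[z^*])^*.
  by rewrite -[in LHS](conjCK z) horner_map.
have sz (p : {poly C}) : (size p <= n.+1)%N -> (p`_n)^* = p`_n ->
    (size (map_poly Num.conj p - p)%R <= n)%N.
  move=> sp pn; apply: size_shrink.
    apply: leq_trans (size_polyD _ _) _; rewrite geq_max size_polyN sp andbT.
    exact: leq_trans (size_poly _ _) sp.
  by rewrite coefB coef_map /= pn subrr.
have [||a ap|/eqP + /eqP] :=
  @XYfree (map_poly Num.conj polX - polX) (map_poly Num.conj polY - polY).
- by apply: sz size_polX _; rewrite polX_top; case: (odd n); rewrite ?conjC0.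
- by apply: sz size_polY _; rewrite polY_top; case: (odd n); rewrite ?conjC0.
- rewrite !hornerD !hornerN !horJ.
  have v1 := comb_vanish ap.
  have := comb_vanish (etrans (pmptsJ a) ap).
  move=> /(congr1 Num.conj); rewrite rmorphD !rmorphM /= XJ YJ !conjCK conjC0 => v2.
  by rewrite !mulrBl addrACA v2 -opprD v1 subr0.
by rewrite !subr_eq0 => /eqP -> /eqP ->.
Qed.

(** With X, Y = A, B this is calA, and with X, Y = B, A this is calB, for the
    appropriate sign eps. *)
Definition bordered := by_continuity (poles s) (fun w => eps * det_quotient X Y s w).

Lemma horner_entire (p : {poly C}) : entire (fun w => p.[w]).
Proof.
elim/poly_ind: p => [|p d IH].
  by apply: (@eq_entire R _ _ _ (@entire_cst R 0)) => w; rewrite horner0.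
have e : entire (fun w => p.[w] * w + d).
  exact: (entireD (entireM IH (@entire_id R)) (@entire_cst R d)).
by apply: (@eq_entire R _ _ _ e) => w; rewrite hornerMXaddC.
Qed.

Lemma bordered_mul : entire bordered /\
  forall w, pmprod w * bordered w = polX.[w] * X w + polY.[w] * Y w.
Proof.
have eN : entire (fun w => polX.[w] * X w + polY.[w] * Y w).
  have e1 := entireM (@horner_entire polX) eX.
  exact: (entireD e1 (entireM (@horner_entire polY) eY)).
have [Q eQ NQ] := entire_div_prod eN uniq_pmpts comb_vanish.
suff -> : bordered = Q by split=> // w; rewrite NQ.
apply: (@by_continuity_eq R _ pmpts).
- move=> w [[i _ <-]|[i _ <-]]; first exact: mem_ppt.
  by rewrite sJ mem_mpt.
- move=> w wS; have w0 : pmprod w != 0.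
    rewrite pmprod_neq0; apply/negP => /pmptsP[i [e|e]]; apply: wS.
      by left; exists i.
    by right; exists i; rewrite ?sJ.
  apply: (mulfI w0); rewrite -NQ bord_comb /det_quotient gamma_star.
  by rewrite -/U -/(bord w); field; rewrite detU_neq0 w0.
- by move=> w; exact: (entire_ccont eQ).
Qed.

Lemma bordered_parity w : bordered (- w) = delta * bordered w.
Proof.
have [eQ QE] := bordered_mul.
suff : (fun w => bordered (- w)) = (fun w => delta * bordered w).
  by move=> /(congr1 (@^~ w)).
apply: (@eq_off_seq _ pmpts) => [z|z|z zp].
- have m1 : -1 != 0 :> C by rewrite oppr_eq0 oner_eq0.
  apply: (@entire_ccont R); apply: (@eq_entire R _ _ _ (entire_scale m1 eQ)) => x.
  by rewrite mulN1r.
- exact: (entire_ccont (entireM (@entire_cst R delta) eQ)).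
have z0 : pmprod z != 0 by rewrite pmprod_neq0.
apply: (mulfI z0); rewrite -{1}pmprodN QE parity_comb; try exact: polX_even; try exact: polY_odd.
by rewrite mulrCA QE.
Qed.

Lemma bordered_conj w : bordered w^* = (bordered w)^*.
Proof.
have [eQ QE] := bordered_mul; have [qJ rJ] := pol_real.
suff : star bordered = bordered.
  by move=> /(congr1 (@^~ w)); rewrite /star => <-; rewrite conjCK.
apply: (@eq_off_seq _ pmpts) => [z|z|z zp].
- exact: (entire_ccont (entire_star eQ)).
- exact: (entire_ccont eQ).
have z0 : pmprod z != 0 by rewrite pmprod_neq0.
apply: (mulfI z0); rewrite QE /star.
rewrite -[pmprod z]conjCK -pmprodJ -rmorphM /= QE rmorphD !rmorphM /= XJ YJ !conjCK.
by rewrite -!horner_map /= qJ rJ conjCK.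
Qed.

Lemma bordered_form : exists q r : {poly C},
  [/\ (size q <= n.+1)%N, (size r <= n.+1)%N, q`_n = (if odd n then 0 else eps),
      r`_n = (if odd n then eps else 0) &
      forall w, pmprod w * bordered w = q.[w] * X w + r.[w] * Y w].
Proof.
exists polX, polY; split; [exact: size_polX|exact: size_polY|exact: polX_top|exact: polY_top|].
exact: bordered_mul.2.
Qed.

End BorderedDeterminant.

(** * Limits of complex sequences *)

Section Limits.
Context {R : realType}.
Local Notation C := R[i].
Implicit Types (f g : C -> C) (z w a : C).

Definition ccvg (T : Type) (u : T -> C) (Fil : set_system T) (a : C) :=
  (u : T -> C^o) @ Fil --> (a : C^o).

Lemma cvg_ccont (T : Type) (Fil : set_system T) (FF : Filter Fil) (u : T -> C) f a :
  ccont f a -> ccvg u Fil a -> ccvg (fun t => f (u t)) Fil (f a).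
Proof. by move=> cf ua; exact: (@cvg_comp _ C^o C^o u f _ _ _ ua cf). Qed.

Lemma cvg_mul (T : Type) (Fil : set_system T) (FF : Filter Fil) (u v : T -> C) a b :
  ccvg u Fil a -> ccvg v Fil b ->
  ccvg (fun t => u t * v t) Fil (a * b).
Proof. exact: (@cvgM C T Fil FF u v a b). Qed.

Lemma cvg_add (T : Type) (Fil : set_system T) (FF : Filter Fil) (u v : T -> C) a b :
  ccvg u Fil a -> ccvg v Fil b -> ccvg (fun t => u t + v t) Fil (a + b).
Proof. exact: (@cvgD C C^o T Fil FF u v a b). Qed.

Lemma cvg_sub (T : Type) (Fil : set_system T) (FF : Filter Fil) (u v : T -> C) a b :
  ccvg u Fil a -> ccvg v Fil b ->
  ccvg (fun t => u t - v t) Fil (a - b).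
Proof. exact: (@cvgB C C^o T Fil FF u v a b). Qed.

Lemma cvg_inverse (T : Type) (Fil : set_system T) (FF : Filter Fil) (u : T -> C) a :
  a != 0 -> ccvg u Fil a -> ccvg (fun t => (u t)^-1) Fil a^-1.
Proof. by move=> a0; exact: (@cvgV C T Fil FF u a a0). Qed.

Lemma cvg_const (T : Type) (Fil : set_system T) (FF : Filter Fil) a :
  ccvg (fun=> a) Fil a.
Proof. exact: (@cvg_cst C^o a T Fil FF). Qed.

Lemma ccvg_fst (u : nat -> C) a : ccvg u \oo a ->
  ccvg (fun p : nat * nat => u p.1) (filter_prod \oo \oo) a.
Proof.
move=> ua S aS; exists (u @^-1` S, setT); first by split; [exact: ua|exact: filterT].
by move=> [? ?] [].
Qed.

Lemma ccvg_snd (u : nat -> C) a : ccvg u \oo a ->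
  ccvg (fun p : nat * nat => u p.2) (filter_prod \oo \oo) a.
Proof.
move=> ua S aS; exists (setT, u @^-1` S); first by split; [exact: filterT|exact: ua].
by move=> [? ?] [].
Qed.

Lemma cvg_seqP (u : nat -> C) a : ccvg u \oo a <->
  forall e : C, 0 < e -> exists N, forall m, (N <= m)%N -> `|a - u m| < e.
Proof.
split=> [/(@cvgrPdist_lt C C^o nat \oo _ u a) h e e0|h].
  by have [N _ hN] := h e e0; exists N => m; exact: hN.
apply/(@cvgrPdist_lt C C^o nat \oo _ u a) => e e0.
by have [N hN] := h e e0; exists N.
Qed.

Lemma cvg_seq_unique (u : nat -> C) a b :
  ccvg u \oo a -> ccvg u \oo b -> a = b.
Proof.
move=> ua ub; have <- := cvg_lim (@norm_hausdorff C C^o) ua.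
by rewrite (cvg_lim (@norm_hausdorff C C^o) ub).
Qed.

Lemma cvg_invS : ccvg (fun m => m.+1%:R^-1) \oo 0.
Proof.
apply/cvg_seqP => e /posCE[e0 ->].
exists (Num.bound (complex.Re e)^-1) => m Nm.
rewrite sub0r normrN ger0_norm ?invr_ge0 ?ler0n //.
have -> : (m.+1%:R^-1 : C) = (m.+1%:R^-1 : R)%:C%C by rewrite fmorphV rmorph_nat.
rewrite ltcR -[ltRHS]invrK ltf_pV2 ?posrE ?invr_gt0 ?ltr0n //.
have b0 : 0 <= (complex.Re e)^-1 by rewrite invr_ge0 ltW.
apply: lt_le_trans (archi_boundP b0) _.
by rewrite ler_nat; exact: leqW.
Qed.

End Limits.

(** * Limits of evaluators *)

Section ReproducingLimit.
Context {R : realType}.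
Local Notation C := R[i].
Implicit Types (F f g : C -> C) (z w a : C).
Variables (H : fun_space R) (P : C -> C) (K : C -> C -> C).
Hypotheses (hH : hilbert_of_entire H) (eP : entire P).
Hypothesis eK : forall z, entire (K z).

(** P K z is the image in H of the candidate evaluator K z of H(sigma). *)
Definition reproduces z := carrier H (fun w => P w * K z w) /\
  forall F, entire F -> carrier H (fun w => P w * F w) ->
    ip H (fun w => P w * K z w) (fun w => P w * F w) = F z.

(** By the reproducing property the scalar products of the functions P K (zs m)
    are values of K at the points zs m. When these values converge, the
    functions form a Cauchy sequence of H. Its limit is P K z0 since evaluations
    are continuous, and the reproducing property passes to the limit. *)
Lemma reproducing_limit (zs : nat -> C) z0 (L : C) (N : C -> C -> C) :
  ccvg zs \oo z0 ->
  ccvg (fun m => (zs m)^*) \oo z0^* ->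
  (forall m, reproduces (zs m)) ->
  (forall e : C, 0 < e -> exists M, forall m k, (M <= m)%N -> (M <= k)%N ->
     `|K (zs m) (zs k) - L| < e) ->
  (forall z w, K z w * (z^* - w) = N z w) ->
  (forall w, ccvg (fun m => N (zs m) w) \oo (N z0 w)) ->
  reproduces z0.
Proof.
move=> zz zzJ rz joint KN Nz.
pose v m w := P w * K (zs m) w.
have cv m : carrier H (v m) by have [] := rz m.
have vv m k : ip H (v m) (v k) = K (zs k) (zs m).
  exact: ((rz m).2 _ (@eK (zs k)) (cv k)).
have vcauchy e : 0 < e -> exists M, forall m k, (M <= m)%N -> (M <= k)%N ->
    ipnorm H (fun w => v m w - v k w) < e.
  move=> e0; have e4 : 0 < e ^+ 2 / 4 by rewrite divr_gt0 ?exprn_gt0 ?ltr0n.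
  have [M hM] := joint _ e4; exists M => m k Mm Mk.
  have cmk := carrierB hH (cv m) (cv k).
  rewrite -(ltr_pXn2r (n := 2)) ?nnegrE ?ipnorm_ge0 ?ltW // ipnormK.
  rewrite (ipBr hH (cv m) (cv k) cmk) (ipBl hH (cv m) (cv k) (cv m)).
  rewrite (ipBl hH (cv m) (cv k) (cv k)) !vv.
  set x1 := K _ _; set x2 := K _ _; set x3 := K _ _; set x4 := K _ _.
  have -> : x1 - x2 - (x3 - x4) = (x1 - L) - (x2 - L) - ((x3 - L) - (x4 - L)) by ring.
  rewrite -[ltLHS]ger0_norm; last first.
    have <- : ip H (fun w => v m w - v k w) (fun w => v m w - v k w)
      = (x1 - L) - (x2 - L) - ((x3 - L) - (x4 - L)).
      rewrite (ipBr hH (cv m) (cv k) cmk) (ipBl hH (cv m) (cv k) (cv m)).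
      rewrite (ipBl hH (cv m) (cv k) (cv k)) !vv.
      by rewrite -/x1 -/x2 -/x3 -/x4; ring.
    exact: hoe_ip_ge0.
  apply: le_lt_trans (ler_normB _ _) _.
  have -> : e ^+ 2 = (e ^+ 2 / 4 + e ^+ 2 / 4) + (e ^+ 2 / 4 + e ^+ 2 / 4) by field.
  apply: ltrD; apply: le_lt_trans (ler_normB _ _) _; apply: ltrD; exact: hM.
have [kap ck kapP] := hoe_complete hH cv vcauchy.
have vlim w : ccvg (fun m => v m w) \oo (kap w).
  apply/cvg_seqP => e e0.
  have [d d0 hd] := hoe_eval_continuous hH w ck e0.
  have [M hM] := kapP d d0; exists M => m Mm; rewrite distrC.
  by apply: hd => //; exact: hM.
have kapE : kap = (fun w => P w * K z0 w).
  apply: (@eq_off_seq R [:: z0^*]).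
  - by move=> w; exact: (entire_ccont (hoe_entire hH ck)).
  - by move=> w; exact: (entire_ccont (entireM eP (@eK z0))).
  move=> w; rewrite inE => wz.
  have wz0 : z0^* - w != 0 by rewrite subr_eq0 eq_sym.
  apply: (mulIf wz0); rewrite -mulrA KN.
  apply: (@cvg_seq_unique R (fun m => v m w * ((zs m)^* - w))).
    exact: (cvg_mul _ (vlim w) (cvg_sub _ zzJ (@cvg_const R nat \oo _ w))).
  rewrite (_ : (fun m => _) = (fun m => P w * N (zs m) w)); last first.
    by apply/funext => m; rewrite /v -mulrA KN.
  exact: (cvg_mul _ (@cvg_const R nat \oo _ (P w)) (Nz w)).
split; first by rewrite -kapE.
move=> F eF cPF; rewrite -kapE.
apply: (@cvg_seq_unique R (fun m => F (zs m))); last first.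
  exact: (cvg_ccont _ (@entire_ccont R F z0 eF) zz).
have M0 := ipnorm_ge0 hH cPF; set M := ipnorm H _ in M0.
have M1 : 0 < M + 1 by rewrite ltr_wpDl.
apply/cvg_seqP => e e0.
have [m0 hm0] := kapP _ (divr_gt0 e0 M1); exists m0 => m mm.
rewrite -((rz m).2 F eF cPF).
rewrite distrC -(ipBl hH (cv m) ck cPF).
apply: le_lt_trans (cauchy_schwarz hH (carrierB hH (cv m) ck) cPF) _; rewrite -/M.
have := hm0 m mm; rewrite ltr_pdivlMr // => h.
apply: le_lt_trans h; rewrite ler_wpM2l ?lerDl ?ler01 //.
by apply: ipnorm_ge0 => //; exact: carrierB.
Qed.

End ReproducingLimit.

(** * The kernel of calA and calB *)

Section Kernel.
Context {R : realType}.
Local Notation C := R[i].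
Implicit Types (w z a u : C) (q r : {poly C}).
Variables (H : fun_space R) (A B : C -> C) (Z : C -> C -> C) (n : nat) (s : 'I_n -> C).
Hypotheses (hH : hilbert_of_entire H) (eA : entire A) (eB : entire B).
Hypotheses (AJ : forall z, A z^* = (A z)^*) (BJ : forall z, B z^* = (B z)^*).
Hypotheses (AN : even_fun A) (BN : odd_fun B).
Hypothesis hZ : forall z, is_evaluator H z (Z z).
Hypothesis ZE : forall a w, Z a^* w * (a - w) = 2 * (B a * A w - A a * B w).
Hypotheses (hs : injective s) (sJ : forall i, (s i)^* = - s i).
Hypothesis ss : forall i j, s i + s j != 0.
Hypothesis hsind : lin_independent (fun i => Z (s i)).

Local Notation sm := [seq - s i | i : 'I_n].
Local Notation pts := (pmpts s).

Lemma s_neq0 i : s i != 0.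
Proof. by apply/negP => /eqP s0; have := ss i i; rewrite s0 addr0 eqxx. Qed.

Lemma Zcarrier z : carrier H (Z z). Proof. by case: (hZ z). Qed.

Lemma sum_sm (f : C -> C) : \sum_(a <- sm) f a = \sum_i f (- s i).
Proof. by rewrite big_map big_enum. Qed.

Lemma prod_sm (f : C -> C) : \prod_(a <- sm) f a = \prod_i f (- s i).
Proof. by rewrite big_map big_enum. Qed.

Lemma size_sm : size sm = n.
Proof. by rewrite size_map size_enum_ord. Qed.

(** By interpolation q A + r B is a sum of terms B(a) A(w) - A(a) B(w) times
    Lagrange polynomials, and such a term is (a - w) Z_(a^* )(w) / 2. *)
Lemma comb_span (p : seq C) (e : C -> C) q r w : uniq p ->
  (size q <= size p)%N -> (size r <= size p)%N ->
  (forall a, a \in p -> q.[a] = e a * B a /\ r.[a] = - (e a * A a)) ->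
  2 * (q.[w] * A w + r.[w] * B w) =
  - (\prod_(a <- p) (w - a)) * \sum_(a <- p) e a / (lagr p a).[a] * Z a^* w.
Proof.
move=> up qp rp he.
rewrite (interpolation up qp (fun a ap => (he a ap).1)).
rewrite (interpolation up rp (fun a ap => (he a ap).2)).
rewrite 2!horner_sum 2!mulr_suml -big_split /= [LHS]mulr_sumr [RHS]mulr_sumr.
apply: eq_big_seq => a ap; rewrite !hornerZ -(lagr_prod w up ap).
have L0 := lagr_self p a.
transitivity (e a / (lagr p a).[a] * (lagr p a).[w] * (2 * (B a * A w - A a * B w))).
  by field.
by rewrite -ZE; field.
Qed.

(** Otherwise Z_(s_i) would vanish at s_i, so would have norm zero. *)
Lemma AB_neq0 i : (A (s i) != 0) || (B (s i) != 0).
Proof.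
rewrite -negb_and; apply/negP => /andP[/eqP A0 /eqP B0].
have := ZE (- s i) (s i); rewrite AN BN A0 B0 oppr0 !mul0r subrr mulr0.
rewrite rmorphN /= sJ opprK => /eqP; rewrite mulf_eq0 -opprD oppr_eq0 (negPf (ss _ _)) orbF.
move=> /eqP; have [cZ ->] := hZ (s i) => // /(hoe_ip_eq0 hH cZ) Z0.
have := hsind (c := fun j => (j == i)%:R); have H1 := oner_neq0 C.
move=> /(_ _ i); rewrite eqxx => H2; case/negP: H1; apply/eqP; apply: H2.
move=> w; rewrite (bigD1 i) //= Z0 mulr0 add0r big1 // => j /negPf ->.
by rewrite mul0r.
Qed.

Lemma AB_neq0_pts a : a \in pts -> (A a != 0) || (B a != 0).
Proof. by move=> /pmptsP[i [->|->]]; rewrite ?AN ?BN ?oppr_eq0 AB_neq0. Qed.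

(** A vector (q a, r a) orthogonal to (A a, B a) is proportional to (B a, - A
    a), and ratio is the factor. *)
Definition ratio q r a := if B a == 0 then - (r.[a] / A a) else q.[a] / B a.

Lemma ratioP q r a : (A a != 0) || (B a != 0) -> q.[a] * A a + r.[a] * B a = 0 ->
  q.[a] = ratio q r a * B a /\ r.[a] = - (ratio q r a * A a).
Proof.
rewrite /ratio; have [->|B0] := eqVneq (B a) 0.
  rewrite orbF => A0 /eqP; rewrite mulr0 addr0 mulf_eq0 (negPf A0) orbF => /eqP ->.
  by rewrite mulr0 mulNr divfK // opprK.
move=> _ e; rewrite divfK //; split=> //.
apply: (mulIf B0); rewrite mulNr mulrAC divfK //; apply/eqP.
by rewrite -subr_eq0 opprK addrC e.
Qed.

(** Interpolation at the - s_i writes q A + r B as prod_i (w + s_i) times a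
    combination g of the Z_(s_i). Then g vanishes at the s_i, so it is
    orthogonal to itself. *)
Lemma AB_free q r : (size q <= n)%N -> (size r <= n)%N ->
  (forall a, a \in pts -> q.[a] * A a + r.[a] * B a = 0) -> q = 0 /\ r = 0.
Proof.
move=> qn rn qr0.
have um := uniq_mpts hs.
have sub a : a \in sm -> a \in pts by rewrite mem_cat => ->; rewrite orbT.
pose d a := ratio q r a / (lagr sm a).[a].
have he a : a \in sm -> q.[a] = ratio q r a * B a /\ r.[a] = - (ratio q r a * A a).
  by move=> /sub ap; apply: ratioP; [exact: AB_neq0_pts|exact: qr0].
have span w : 2 * (q.[w] * A w + r.[w] * B w) =
    - (\prod_(a <- sm) (w - a)) * \sum_(a <- sm) d a * Z a^* w.
  by apply: comb_span; rewrite ?size_sm.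
pose g w := \sum_i d (- s i) * Z (s i) w.
have gE w : \sum_(a <- sm) d a * Z a^* w = g w.
  by rewrite sum_sm; apply: eq_bigr => i _; rewrite rmorphN /= sJ opprK.
have cg : carrier H g.
  exact: (carrier_sum hH _ (fun i => d (- s i)) (fun i => Zcarrier (s i))).
have g0 i : g (s i) = 0.
  have := span (s i); rewrite qr0 ?mem_ppt // mulr0 gE => /esym/eqP.
  rewrite mulf_eq0 oppr_eq0 => /orP[|/eqP//].
  rewrite prod_sm prodf_seq_eq0 => /hasP[j _] /=.
  by rewrite opprK (negPf (ss _ _)).
have gg : ip H g g = 0.
  rewrite {1}/g (ip_suml hH _ (fun i => d (- s i)) (fun i => Zcarrier (s i)) cg).
  by rewrite big1 // => i _; have [_ <-] := hZ (s i); rewrite ?g0 ?mulr0.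
have gz := hoe_ip_eq0 hH cg gg.
have d0 : forall i, d (- s i) = 0.
  apply: (hsind (c := fun i => d (- s i))) => w.
  exact: (congr1 (@^~ w) gz).
have r0 a : a \in sm -> ratio q r a = 0.
  move=> am; case/mapP: (am) => i _ ai; have := d0 i; rewrite -ai => /eqP.
  by rewrite mulf_eq0 invr_eq0 (negPf (lagr_self _ _)) orbF => /eqP.
split; apply: (poly_eq0_roots um); rewrite ?size_sm // => a am.
  by rewrite (he a am).1 r0 ?mul0r.
by rewrite (he a am).2 r0 ?mul0r ?oppr0.
Qed.

Lemma BA_free q r : (size q <= n)%N -> (size r <= n)%N ->
  (forall a, a \in pts -> q.[a] * B a + r.[a] * A a = 0) -> q = 0 /\ r = 0.
Proof.
move=> qn rn h; have [|r0 q0] := AB_free rn qn; last by split.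
by move=> a ap; rewrite addrC h.
Qed.

Let epsA : C := (-1) ^+ ((n * n.-1)./2).
Let epsB : C := (-1) ^+ ((n * n.+1)./2).

Lemma signJ (k : nat) : ((-1) ^+ k : C)^* = (-1) ^+ k.
Proof. by rewrite rmorphXn /= rmorphN1. Qed.

Local Notation cA := (calA A B s).
Local Notation cB := (calB A B s).
Local Notation PP := (pmprod s).

Lemma A1N z : A (- z) = 1 * A z. Proof. by rewrite AN mul1r. Qed.
Lemma B1N z : B (- z) = - (1 * B z). Proof. by rewrite BN mul1r. Qed.
Lemma BN1 z : B (- z) = -1 * B z. Proof. by rewrite BN mulN1r. Qed.
Lemma AN1 z : A (- z) = - (-1 * A z). Proof. by rewrite AN mulN1r opprK. Qed.

Lemma calA_entire : entire cA.
Proof. exact: (bordered_mul epsA eA eB A1N B1N hs sJ ss AB_free).1. Qed.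
Lemma calB_entire : entire cB.
Proof. exact: (bordered_mul epsB eB eA BN1 AN1 hs sJ ss BA_free).1. Qed.

Lemma calA_conj z : cA z^* = (cA z)^*.
Proof. exact: (bordered_conj eA eB AJ BJ A1N B1N hs sJ ss (signJ _) AB_free). Qed.
Lemma calB_conj z : cB z^* = (cB z)^*.
Proof. exact: (bordered_conj eB eA BJ AJ BN1 AN1 hs sJ ss (signJ _) BA_free). Qed.

Lemma calA_even : even_fun cA.
Proof.
move=> z; rewrite -[RHS]mul1r.
exact: (bordered_parity epsA eA eB A1N B1N hs sJ ss AB_free z).
Qed.
Lemma calB_odd : odd_fun cB.
Proof.
move=> z; rewrite -[RHS]mulN1r.
exact: (bordered_parity epsB eB eA BN1 AN1 hs sJ ss BA_free z).
Qed.

(** The exponents add up to n^2. *)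
Lemma eps_mul : epsA * epsB = (-1) ^+ n.
Proof.
have ev : odd (n * n.-1) = false by case: n => //= m; rewrite oddM /= andNb.
have h : (n * n.+1 = n * n.-1 + n.*2)%N.
  by case: n => // m; rewrite -muln2 -mulnDr addn2.
have -> : epsA * epsB = (-1) ^+ ((n * n.-1)./2 + (n * n.+1)./2) by rewrite exprD.
have -> : ((n * n.-1)./2 + (n * n.+1)./2 = n * n)%N.
  rewrite h halfD ev /= add0n doubleK addnA addnn even_halfK ?ev //.
  by case: n => // m; rewrite -mulnSr.
by rewrite -signr_odd oddM andbb signr_odd.
Qed.

(** The difference of the two sides has degree less than 2n, because both are
    monic of degree 2n, and it vanishes at the 2n points +-s_i, where the pair
    (A, B) is a nonzero solution of a homogeneous linear system with matrix (a1,
    b1; b2, a2). *)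
Lemma delta_prod : exists a1 b1 a2 b2 : {poly C},
  [/\ [/\ (size a1 <= n.+1)%N, (size b1 <= n.+1)%N,
          (size a2 <= n.+1)%N & (size b2 <= n.+1)%N],
      forall w, PP w * cA w = a1.[w] * A w + b1.[w] * B w,
      forall w, PP w * cB w = a2.[w] * B w + b2.[w] * A w &
      forall w, a1.[w] * a2.[w] - b1.[w] * b2.[w] = PP w].
Proof.
have [a1 [b1 [sa1 sb1 ta1 tb1 E1]]] := bordered_form epsA eA eB A1N B1N hs sJ ss AB_free.
have [a2 [b2 [sa2 sb2 ta2 tb2 E2]]] := bordered_form epsB eB eA BN1 AN1 hs sJ ss BA_free.
exists a1, b1, a2, b2; split=> // w.
pose D : {poly C} := \prod_(a <- pts) ('X - a%:P).
have sD : size D = (n + n).+1 by rewrite size_prod_XsubC size_pmpts.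
have PPE z : PP z = D.[z].
  by rewrite horner_prod; apply: eq_bigr => a _; rewrite hornerXsubC.
suff /eqP : a1 * a2 - b1 * b2 - D = 0.
  by rewrite subr_eq0 PPE => /eqP <-; rewrite hornerD hornerN !hornerM.
apply: (poly_eq0_roots (uniq_pmpts hs ss)).
  rewrite size_pmpts; apply/leq_sizeP => j; rewrite leq_eqVlt => /orP[/eqP<-|nj].
    rewrite !coefB !coef_top_mul // ta1 ta2 tb1 tb2.
    have -> : D`_(n + n) = 1.
      by have /monicP := monic_prod_XsubC pts xpredT id; rewrite lead_coefE -/D sD.
    have := eps_mul; rewrite -(signr_odd _ n); case: (odd n).
      by rewrite expr1 mulr0 sub0r => ->; rewrite opprK subrr.
    by rewrite expr0 mulr0 subr0 => ->; rewrite subrr.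
  rewrite !coefB (coef_high_mul sa1 sa2 nj) (coef_high_mul sb1 sb2 nj) subrr sub0r.
  by rewrite nth_default ?oppr0 // sD.
move=> a ap; have P0 : PP a = 0 by apply/eqP; rewrite -[_ == _]negbK pmprod_neq0 ap.
rewrite !hornerD !hornerN !hornerM -PPE P0 subr0.
have := E1 a; have := E2 a; rewrite P0 !mul0r => /esym e2 /esym e1.
have /orP[A0|B0] := AB_neq0_pts ap.
- apply: (mulfI A0); rewrite mulr0.
  transitivity (a2.[a] * (a1.[a] * A a + b1.[a] * B a)
    - b1.[a] * (a2.[a] * B a + b2.[a] * A a)); first by ring.
  by rewrite e1 e2 !mulr0 subrr.
- apply: (mulfI B0); rewrite mulr0.
  transitivity (a1.[a] * (a2.[a] * B a + b2.[a] * A a)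
    - b2.[a] * (a1.[a] * A a + b1.[a] * B a)); first by ring.
  by rewrite e1 e2 !mulr0 subrr.
Qed.

Definition sigma_poly w := \prod_i (w - s i).
Local Notation P := sigma_poly.
Local Notation K := (kernel_of cA cB).

(** The numerator vanishes at z^* because calA and calB commute with
    conjugation. *)
Lemma kernel_eq z : entire (K z) /\
  forall w, K z w * (z^* - w) = 2 * (cB z^* * cA w - cA z^* * cB w).
Proof.
have e1 := entireM (@entire_cst R (cB z^*)) calA_entire.
have eN := entireB e1 (entireM (@entire_cst R (cA z^*)) calB_entire).
have [|g eg Ng] := entire_div (a := z^*) eN; first by rewrite mulrC subrr.
have eK := entireM (@entire_cst R (- 2)) eg.
have -> : K z = (fun w => - 2 * g w).
  apply: (@by_continuity_eq R _ [:: z^*]).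
  - by move=> w ->; rewrite inE.
  - move=> w wz; rewrite -calB_conj -calA_conj Ng.
    have wz0 : z^* - w != 0 by rewrite subr_eq0; apply/negP => /eqP e; apply: wz.
    by field.
  - by move=> w; exact: (entire_ccont eK).
by split=> // w; rewrite Ng; ring.
Qed.

Lemma entire_prod (p : seq C) : entire (fun w => \prod_(a <- p) (w - a)).
Proof.
have e : entire (fun w => (\prod_(a <- p) ('X - a%:P)).[w]) by exact: horner_entire.
apply: (@eq_entire R _ _ _ e) => w; rewrite horner_prod.
by apply: eq_bigr => a _; rewrite hornerXsubC.
Qed.

Lemma sigma_polyE w : P w = \prod_(a <- [seq s i | i : 'I_n]) (w - a).
Proof. by rewrite big_map big_enum. Qed.

Lemma sigma_poly_entire : entire P.
Proof. exact: (@eq_entire R _ _ (fun w => esym (sigma_polyE w)) (@entire_prod _)). Qed.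

(** The numerator of K z is a combination of A and B to which comb_span applies
    with the points z^* and - s_i: P K z is a combination of Z_z and of the
    Z_(s_i), and the latter are orthogonal to the functions P F. *)
Lemma kernel_regular z : z \notin pts -> reproduces H P K z.
Proof.
move=> zp; have [a1 [b1 [a2 [b2 [[sa1 sb1 sa2 sb2] E1 E2 E3]]]]] := delta_prod.
have [eK KE] := kernel_eq z.
pose u := z^*; have uz : u^* = z by rewrite conjCK.
have up : u \notin pts by rewrite pmptsJ.
have usm : u \notin sm by apply: contra up => h; rewrite mem_cat h orbT.
pose p := u :: sm.
have pu : uniq p by rewrite /= usm uniq_mpts.
have szp : size p = n.+1 by rewrite /= size_sm.
pose q : {poly C} := cB u *: a1 - cA u *: b2.
pose r : {poly C} := cB u *: b1 - cA u *: a2.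
have qr w : q.[w] * A w + r.[w] * B w = PP w * (cB u * cA w - cA u * cB w).
  transitivity (cB u * (PP w * cA w) - cA u * (PP w * cB w)); last by ring.
  by rewrite /q /r !hornerD !hornerN !hornerZ E1 E2; ring.
have PPu : PP u != 0 by rewrite pmprod_neq0.
have qu : q.[u] = B u.
  apply: (mulfI PPu); rewrite /q hornerD hornerN !hornerZ mulrBr !mulrA E1 E2.
  by rewrite -E3; ring.
have ru : r.[u] = - A u.
  apply: (mulfI PPu); rewrite /r hornerD hornerN !hornerZ mulrBr !mulrA E1 E2.
  by rewrite -E3; ring.
(* A and B might both vanish at u, where ratio would then be meaningless. *)
pose e a := if a == u then 1 else ratio q r a.
have he a : a \in p -> q.[a] = e a * B a /\ r.[a] = - (e a * A a).
  rewrite inE /e => /orP[/eqP->|am]; first by rewrite eqxx !mul1r.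
  case: eqP => [au|_]; first by move: usm; rewrite -au am.
  have ap : a \in pts by rewrite mem_cat am orbT.
  apply: ratioP; first exact: AB_neq0_pts.
  have : PP a = 0 by apply/eqP; rewrite -[_ == _]negbK pmprod_neq0 ap.
  by rewrite qr => ->; rewrite mul0r.
pose d a := e a / (lagr p a).[a].
have span w : 2 * (PP w * (cB u * cA w - cA u * cB w)) =
    - ((w - u) * \prod_i (w + s i)) * \sum_(a <- p) d a * Z a^* w.
  rewrite -qr (comb_span w pu (e := e)) ?szp //.
  - rewrite big_cons prod_sm; congr (- (_ * _) * _).
    by apply: eq_bigr => i _; rewrite opprK.
  - by apply: leq_trans (size_polyD _ _) _; rewrite geq_max size_polyN;
      apply/andP; split; apply: leq_trans (size_scale_leq _ _) _.
  - by apply: leq_trans (size_polyD _ _) _; rewrite geq_max size_polyN;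
      apply/andP; split; apply: leq_trans (size_scale_leq _ _) _.
pose v a := Z a^*.
have cv a : carrier H (v a) by exact: Zcarrier.
have csum := carrier_sum hH p d cv.
have PK : (fun w => P w * K z w) = (fun w => \sum_(a <- p) d a * v a w).
  apply: (@eq_off_seq R (u :: pts)).
  - by move=> w; exact: (entire_ccont (entireM sigma_poly_entire eK)).
  - by move=> w; exact: (entire_ccont (hoe_entire hH csum)).
  move=> w; rewrite inE negb_or => /andP[wu wp].
  have uw : u - w != 0 by rewrite subr_eq0 eq_sym.
  have PPw : PP w != 0 by rewrite pmprod_neq0.
  have Qw : \prod_i (w + s i) != 0.
    by apply/negP => /eqP Q0; move: PPw; rewrite pmprodE Q0 mulr0 eqxx.
  apply: (mulIf uw); apply: (mulIf Qw).
  transitivity (PP w * (K z w * (z^* - w))); first by rewrite pmprodE -/(P w); ring.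
  rewrite KE -/u mulrCA span; ring.
split; first by rewrite PK.
move=> F _ cF.
have Fs i : P (s i) = 0 by apply/eqP; rewrite /sigma_poly (bigD1 i) //= subrr mul0r.
rewrite PK (ip_suml hH p d cv cF).
have ev a : ip H (v a) (fun w => P w * F w) = P a^* * F a^*.
  by have [_ <-] := hZ a^*.
rewrite big_cons ev sum_sm big1 ?addr0; last first.
  by move=> i _; rewrite ev rmorphN /= sJ opprK Fs mul0r mulr0.
rewrite uz mulrA -[RHS]mul1r; congr (_ * _).
rewrite /d /e eqxx mul1r fmorphV /=.
suff -> : ((lagr p u).[u])^* = P z.
  rewrite mulVf //; apply/negP => /eqP P0; move: PPu.
  by rewrite (pmprodJ sJ) pmprodE -/(P z) P0 mul0r conjC0 eqxx.
rewrite /lagr big_cons eqxx /= horner_prod rmorph_prod /=.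
rewrite big_mkcond big_map big_enum /= /sigma_poly; apply: eq_bigr => i _.
have -> : - s i != u.
  by apply: contra usm => /eqP <-; apply/mapP; exists i; rewrite ?mem_enum.
by rewrite hornerXsubC rmorphB /= uz rmorphN /= sJ opprK.
Qed.

Lemma pts_conj a : a \in pts -> a^* = - a.
Proof. by move=> /pmptsP[i [->|->]]; rewrite ?rmorphN /= sJ. Qed.

Lemma pts_neq0 a : a \in pts -> a != 0.
Proof. by move=> /pmptsP[i [->|->]]; rewrite ?oppr_eq0 s_neq0. Qed.

(** The points z0 + 1 / (m + 1) are not imaginary, so they are regular. As z0 is
    not real, the denominators of the kernel stay away from 0. *)
Lemma kernel_pole z0 : z0 \in pts -> reproduces H P K z0.
Proof.
move=> z0p; have z0J := pts_conj z0p; have z00 := pts_neq0 z0p.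
(* A real shift leaves the imaginary axis. *)
pose t m : C := m.+1%:R^-1.
pose zs m := z0 + t m.
have tJ m : (t m)^* = t m by rewrite /t fmorphV /= rmorph_nat.
have zsJ m : (zs m)^* = - z0 + t m by rewrite rmorphD /= z0J tJ.
have t0 m : t m != 0 by rewrite invr_eq0 pnatr_eq0.
have two : 2 != 0 :> C by rewrite pnatr_eq0.
have zsp m : zs m \notin pts.
  apply/negP => /pts_conj; rewrite zsJ /zs opprD => /addrI /eqP.
  rewrite -subr_eq0 opprK -mulr2n -mulr_natl mulf_eq0 (negPf two) (negPf (t0 m)).
  by [].
have z2 : z0^* - z0 != 0.
  by rewrite z0J -opprD oppr_eq0 -mulr2n -mulr_natl mulf_neq0.
have den m k : (zs m)^* - zs k != 0.
  apply/negP => /eqP e; have : (zs m)^* - zs k + (zs k)^* - zs m = 0.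
    have := congr1 Num.conj e; rewrite rmorphB /= conjCK conjC0 => e2.
    by rewrite -addrA -[(zs k)^* - zs m]opprB e2 e oppr0 addr0.
  rewrite !zsJ /zs => /eqP.
  have -> : - z0 + t m - (z0 + t k) + (- z0 + t k) - (z0 + t m) = - (2 * (2 * z0)) by ring.
  by rewrite oppr_eq0 !mulf_eq0 (negPf two) (negPf z00).
have zz : ccvg zs \oo z0.
  rewrite -[X in ccvg _ _ X]addr0.
  exact: (cvg_add _ (@cvg_const R nat \oo _ z0) (@cvg_invS R)).
have zzJ : ccvg (fun m => (zs m)^*) \oo z0^*.
  rewrite (_ : (fun m => _) = (fun m => - z0 + t m)); last exact/funext.
  rewrite z0J -[X in ccvg _ _ X]addr0.
  exact: (cvg_add _ (@cvg_const R nat \oo _ (- z0)) (@cvg_invS R)).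
pose N z w := 2 * (cB z^* * cA w - cA z^* * cB w).
have contA w : ccont cA w := entire_ccont calA_entire.
have contB w : ccont cB w := entire_ccont calB_entire.
apply: (@reproducing_limit R H P K hH sigma_poly_entire (fun z => (kernel_eq z).1) zs z0
  (K z0 z0) N zz zzJ).
- by move=> m; exact: kernel_regular.
- move=> e e0.
  have a1 : ccvg (fun p => (zs p.1)^*) (filter_prod \oo \oo) z0^*.
    exact: (ccvg_fst zzJ).
  have a2 : ccvg (fun p => zs p.2) (filter_prod \oo \oo) z0.
    exact: (ccvg_snd zz).
  have lim : ccvg (fun p => N (zs p.1) (zs p.2) * ((zs p.1)^* - zs p.2)^-1)
      (filter_prod \oo \oo) (N z0 z0 * (z0^* - z0)^-1).
    apply: cvg_mul; last exact: (cvg_inverse _ z2 (cvg_sub _ a1 a2)).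
    apply: cvg_mul; first exact: cvg_const.
    apply: cvg_sub.
      exact: (cvg_mul _ (cvg_ccont _ (contB _) a1) (cvg_ccont _ (contA _) a2)).
    exact: (cvg_mul _ (cvg_ccont _ (contA _) a1) (cvg_ccont _ (contB _) a2)).
  have KE z w : z^* - w != 0 -> K z w = N z w * (z^* - w)^-1.
    by move=> zw; apply: (mulIf zw); rewrite (kernel_eq z).2 divfK.
  move: lim; rewrite -(KE _ _ z2).
  move=> /(@cvgrPdist_lt C C^o (nat * nat)%type _ _ _ _) /(_ e e0).
  move=> [[S1 S2] [/= [M1 _ h1] [M2 _ h2]] h].
  exists (maxn M1 M2) => m k; rewrite !geq_max => /andP[m1 _] /andP[_ k2].
  have := h (m, k) (conj (h1 m m1) (h2 k k2)).
  by rewrite /= -(KE _ _ (den m k)) distrC.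
- by move=> z w; exact: (kernel_eq z).2.
move=> w; apply: cvg_mul; first exact: cvg_const.
apply: cvg_sub.
  exact: (cvg_mul _ (cvg_ccont _ (contB _) zzJ) (@cvg_const R nat \oo _ _)).
exact: (cvg_mul _ (cvg_ccont _ (contA _) zzJ) (@cvg_const R nat \oo _ _)).
Qed.

Lemma kernel_reproduces z : reproduces H P K z.
Proof. by case: (boolP (z \in pts)) => [/kernel_pole|/kernel_regular]. Qed.

End Kernel.

(** * The space H(sigma) *)

Section Hsigma.
Context {R : realType}.
Local Notation C := R[i].
Implicit Types (F G f g : C -> C) (z w : C).
Variables (H : fun_space R) (n : nat) (s : 'I_n -> C).
Hypotheses (hH : hilbert_of_entire H) (hs : injective s).
Local Notation Hs := (Hsigma H s).
Local Notation PF F := (fun w => sigma_poly s w * F w).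

Lemma mul_gammaE F : entire F -> mul_gamma s (PF F) = F.
Proof.
move=> eF; apply: (@by_continuity_eq R _ [seq s i | i : 'I_n]).
- by move=> w [i _ <-]; apply/mapP; exists i; rewrite ?mem_enum.
- move=> w wS; rewrite /gamma mulrA /sigma_poly -big_split big1 ?mul1r // => i _ /=.
  by rewrite mulVf // subr_eq0; apply/eqP => e; apply: wS; exists i.
- by move=> w; exact: (entire_ccont eF).
Qed.

(** A function of H vanishing at the s_i is divisible by prod_i (w - s_i). *)
Lemma Hsigma_carrier F : carrier Hs F <-> entire F /\ carrier H (PF F).
Proof.
split=> [[f [cf f0] <-]|[eF cF]]; last first.
  exists (PF F); last exact: mul_gammaE.
  by split=> // i; rewrite /sigma_poly (bigD1 i) //= subrr !mul0r.
have us : uniq [seq s i | i : 'I_n] by rewrite map_inj_uniq ?enum_uniq.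
have f0' : {in [seq s i | i : 'I_n], forall a, f a = 0}.
  by move=> a /mapP[i _ ->].
have [g eg fg] := entire_div_prod (hoe_entire hH cf) us f0'.
have -> : f = PF g by apply/funext => w; rewrite fg sigma_polyE.
rewrite mul_gammaE //; split=> //.
by rewrite (_ : PF g = f) //; apply/funext => w; rewrite fg sigma_polyE.
Qed.

Lemma PF_inj F : entire F -> PF F = (fun=> 0) -> F = (fun=> 0).
Proof.
move=> eF e; apply: (@eq_off_seq R [seq s i | i : 'I_n]) => [w|w|w ws].
- exact: (entire_ccont eF).
- exact: ccont_cst.
have Pw : sigma_poly s w != 0.
  rewrite sigma_polyE prodf_seq_neq0; apply/allP => a am; apply/implyP => _.
  by rewrite subr_eq0; apply: contra ws => /eqP ->.
by apply: (mulfI Pw); rewrite mulr0; exact: (congr1 (@^~ w) e).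
Qed.

Lemma PF_lin a F G : PF (fun w => a * F w + G w) = (fun w => a * PF F w + PF G w).
Proof. by apply/funext => w; ring. Qed.

Lemma PF_sub F G : PF (fun w => F w - G w) = (fun w => PF F w - PF G w).
Proof. by apply/funext => w; ring. Qed.

Lemma ipnorm_Hsigma F : ipnorm Hs F = ipnorm H (PF F).
Proof. by []. Qed.

Variable K : C -> C -> C.
Hypothesis eK : forall z, entire (K z).
Hypothesis repK : forall z, reproduces H (sigma_poly s) K z.

Lemma Hsigma_evaluator z : is_evaluator Hs z (K z).
Proof.
have [cK KE] := repK z; split; first by apply/Hsigma_carrier; split; [exact: eK|].
by move=> F /Hsigma_carrier[eF cF]; rewrite -(KE F eF cF).
Qed.

(** Everything is transported from H by multiplication by prod_i (w - s_i),
    except the continuity of evaluations, which at the s_i cannot be read off H.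
    It follows from the existence of evaluators and the Cauchy-Schwarz
    inequality. *)
Lemma Hsigma_hilbert : hilbert_of_entire Hs.
Proof.
have PF0 : PF (fun=> 0) = (fun=> 0) by apply/funext => w; rewrite mulr0.
constructor.
- apply/Hsigma_carrier; split; first exact: (@entire_cst R 0).
  by rewrite PF0; exact: (hoe_zero hH).
- move=> a F G /Hsigma_carrier[eF cF] /Hsigma_carrier[eG cG].
  apply/Hsigma_carrier; split.
    exact: (entireD (entireM (@entire_cst R a) eF) eG).
  by rewrite PF_lin; exact: (hoe_lin hH a cF cG).
- move=> a F G K' /Hsigma_carrier[eF cF] /Hsigma_carrier[eG cG] /Hsigma_carrier[eK' cK'].
  by rewrite /= PF_lin; exact: (hoe_ip_linear_r hH a cF cG cK').
- by move=> F G /Hsigma_carrier[eF cF] /Hsigma_carrier[eG cG]; exact: (hoe_ip_conj hH cF cG).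
- by move=> F /Hsigma_carrier[eF cF]; exact: (hoe_ip_ge0 hH cF).
- move=> F /Hsigma_carrier[eF cF] /(hoe_ip_eq0 hH cF); exact: (PF_inj eF).
- move=> u cu uC.
  have cPu m : carrier H (PF (u m)) by have /Hsigma_carrier[] := cu m.
  have [|f cf fP] := hoe_complete hH cPu.
    move=> e e0; have [N hN] := uC e e0; exists N => m k Nm Nk.
    by have := hN m k Nm Nk; rewrite ipnorm_Hsigma PF_sub.
  have fs i : f (s i) = 0.
    apply/eqP; rewrite -normr_le0; apply/ler_addgt0Pl => e e0; rewrite addr0.
    have [d d0 hd] := hoe_eval_continuous hH (s i) cf e0.
    have [N hN] := fP d d0.
    have := hd _ (cPu N) (hN N (leqnn N)).
    have -> : sigma_poly s (s i) = 0 by rewrite /sigma_poly (bigD1 i) //= subrr mul0r.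
    by rewrite mul0r sub0r normrN => /ltW.
  have cF : carrier Hs (mul_gamma s f) by exists f.
  exists (mul_gamma s f); first exact: cF.
  have us : uniq [seq s i | i : 'I_n] by rewrite map_inj_uniq ?enum_uniq.
  have f0' : {in [seq s i | i : 'I_n], forall a, f a = 0}.
    by move=> a /mapP[i _ ->].
  have [g eg fg] := entire_div_prod (hoe_entire hH cf) us f0'.
  have fE : f = PF g by apply/funext => w; rewrite fg sigma_polyE.
  have PFf : PF (mul_gamma s f) = f by rewrite fE mul_gammaE.
  move=> e e0; have [N hN] := fP e e0; exists N => m Nm.
  rewrite ipnorm_Hsigma PF_sub.
  rewrite (_ : (fun w => _) = (fun w => PF (u m) w - f w)); first exact: hN.
  by apply/funext => w; rewrite -[in RHS]PFf.
- by move=> F /Hsigma_carrier[].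
- move=> z F /Hsigma_carrier[eF cF] e e0.
  have [cK KE] := repK z.
  have M0 := ipnorm_ge0 hH cK; set M := ipnorm H _ in M0.
  have M1 : 0 < M + 1 by rewrite ltr_wpDl.
  exists (e / (M + 1)); first exact: divr_gt0.
  move=> G /Hsigma_carrier[eG cG]; rewrite ipnorm_Hsigma PF_sub => h.
  rewrite -(KE F eF cF) -(KE G eG cG) -(ipBr hH cG cF cK).
  have cB := carrierB hH cG cF.
  apply: le_lt_trans (cauchy_schwarz hH cK cB) _; rewrite -/M.
  move: h; rewrite ltr_pdivlMr // => h; apply: le_lt_trans h.
  rewrite mulrC ler_wpM2l ?lerDl ?ler01 //.
  exact: (ipnorm_ge0 hH cB).
Qed.

End Hsigma.

Theorem theorem3 (R : realType) (H : fun_space R) (A B : R[i] -> R[i])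
    (Z : R[i] -> R[i] -> R[i]) (n : nat) (s : 'I_n -> R[i])
    (hH : hilbert_of_entire H)
    (hA : entire A) (hB : entire B)
    (hAreal : real_on_reals A) (hBreal : real_on_reals B)
    (hAeven : even_fun A) (hBodd : odd_fun B)
    (hZ : forall z, is_evaluator H z (Z z))
    (hZAB : forall z w, Z z w = kernel_of A B z w)
    (hs : injective s)
    (hsim : forall i, 'Re (s i) = 0)
    (hsind : lin_independent (fun i => Z (s i)))
    (hssum : forall i j, s i + s j != 0) :
  [/\ hilbert_of_entire (Hsigma H s),
      forall z, exists k, is_evaluator (Hsigma H s) z k,
      forall K : R[i] -> R[i] -> R[i],
        (forall z, is_evaluator (Hsigma H s) z (K z)) ->
        forall z w,
          K z w = ip (Hsigma H s) (K w) (K z) /\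
          K z w = kernel_of (calA A B s) (calB A B s) z w,
      [/\ entire (calA A B s), real_on_reals (calA A B s)
        & even_fun (calA A B s)]
    & [/\ entire (calB A B s), real_on_reals (calB A B s)
        & odd_fun (calB A B s)] ].
Proof.
have AJ := reflection hA hAreal; have BJ := reflection hB hBreal.
have sJ i : (s i)^* = - s i.
  rewrite [s i]Crect hsim add0r rmorphM /= conjCi conj_Creal ?Creal_Im //.
  by rewrite mulNr.
have ZE a w : Z a^* w * (a - w) = 2 * (B a * A w - A a * B w).
  have [->|wa] := eqVneq w a; first by rewrite subrr mulr0 [A a * _]mulrC subrr mulr0.
  rewrite hZAB /kernel_of /by_continuity conjCK ifF; last first.
    by apply/negP; rewrite inE => /eqP; exact/negP.
  have aw0 : a - w != 0 by rewrite subr_eq0 eq_sym.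
  by rewrite BJ AJ !conjCK mulrA divfK.
have real_refl (f : R[i] -> R[i]) : (forall z, f z^* = (f z)^*) -> real_on_reals f.
  move=> fJ x; apply/CrealP; rewrite -fJ conj_Creal //.
  by rewrite complex_real.
have eK z := (kernel_eq hH hA hB AJ BJ hAeven hBodd hZ ZE hs sJ hssum hsind z).1.
have repK := kernel_reproduces hH hA hB AJ BJ hAeven hBodd hZ ZE hs sJ hssum hsind.
have hHs := Hsigma_hilbert hH hs repK.
have ev := Hsigma_evaluator hH hs eK repK.
split; first exact: hHs.
- by move=> z; exists (kernel_of (calA A B s) (calB A B s) z).
- move=> K hK z w; split; first exact: ((hK w).2 _ (hK z).1).
  by rewrite (evaluator_unique hHs (hK z) (ev z)).
- split.
  + exact: (calA_entire hH hA hB hAeven hBodd hZ ZE hs sJ hssum hsind).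
  + apply: real_refl.
    exact: (calA_conj hH hA hB AJ BJ hAeven hBodd hZ ZE hs sJ hssum hsind).
  + exact: (calA_even hH hA hB hAeven hBodd hZ ZE hs sJ hssum hsind).
- split.
  + exact: (calB_entire hH hA hB hAeven hBodd hZ ZE hs sJ hssum hsind).
  + apply: real_refl.
    exact: (calB_conj hH hA hB AJ BJ hAeven hBodd hZ ZE hs sJ hssum hsind).
  + exact: (calB_odd hH hA hB hAeven hBodd hZ ZE hs sJ hssum hsind).
Qed.
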